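(* Let $n\geq 19$ with $n\equiv 3\pmod 4$, let $r$ be even with $8\leq r<(n-3)/2$, and put $L=n-2r-2$. Let $V$ consist of the $n$ distinct vertices $p_1,p_2,p_3,q_0=p_4,q_1,\dots,q_L,y_3,\dots,y_{r+1},z_3,\dots,z_{r+1}$, and write $y_2:=q_L$. Consider the labelled graph on $V$ with edges: $\{p_1,p_2\}$ with label $0$; $\{p_2,p_3\}$ with label $1$; $\{p_3,p_4\}$ with the two labels $0$ and $2$; $\{q_{s-1},q_s\}$ for $1\leq s\leq L$ with label $1$ if $s$ is odd and $0$ if $s$ is even; $\{y_k,y_{k+1}\}$ with label $k$ for $2\leq k\leq r-1$; $\{y_r,y_{r+1}\}$ with label $r-2$; $\{z_k,z_{k+1}\}$ with label $k$ for $3\leq k\leq r-1$; $\{z_r,z_{r+1}\}$ with label $r-2$; and $\{y_j,z_j\}$ with label $r-4$ for $j\in\{r-2,r-1,r,r+1\}$. Then $G\cong A_n$ and $(G,(\rho_0,\dots,\rho_{r-1}))$ is a string C-group of rank $r$ with Schläfli type $\{n-2(r-1),12,6,3^{r-8},6,6,6,4\}$.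
   Context: A string group generated by involutions (sggi) of rank $r$ is a pair $(G,(\rho_0,\dots,\rho_{r-1}))$ where $\rho_0,\dots,\rho_{r-1}$ are involutions generating the group $G$ such that $(\rho_i\rho_j)^2=1$ whenever $|i-j|\geq 2$. It is a string C-group if in addition it satisfies the intersection property: for all $J,K\subseteq\{0,\dots,r-1\}$, $\langle \rho_j : j\in J\rangle\cap\langle\rho_k : k\in K\rangle=\langle \rho_j : j\in J\cap K\rangle$. The Schläfli type is $\{p_1,\dots,p_{r-1}\}$ where $p_i$ is the order of $\rho_{i-1}\rho_i$; $3^k$ denotes $k$ consecutive entries equal to $3$ (omitted if $k=0$). Labelled-graph convention: the vertex set $V$ is finite, and each edge $\{a,b\}$ ($a\neq b$) carries one or more labels from $\{0,\dots,r-1\}$, the edges carrying any given label being pairwise disjoint; $\rho_k$ denotes the permutation of $V$ equal to the product of the transpositions $(a\,b)$ over all edges $\{a,b\}$ carrying label $k$, and $G=\langle\rho_0,\dots,\rho_{r-1}\rangle\leq \mathrm{Sym}(V)$. *)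

(* Defs.v *)
From HB Require Import structures.
From mathcomp Require Import all_boot fingroup perm morphism alt.
Set Implicit Arguments. Unset Strict Implicit. Unset Printing Implicit Defensive.
Local Open Scope group_scope.

Section StringC.
Variable gT : finGroupType.

Definition subgen (r : nat) (rho : nat -> gT) (J : {set 'I_r}) : {set gT} :=
  <<[set rho (val j) | j in J]>>.

Definition is_sggi (r : nat) (rho : nat -> gT) : Prop :=
  (forall i, i < r -> #[rho i] = 2)%N /\
  (forall i j, (i < r)%N -> (j < r)%N -> (i + 2 <= j)%N -> (rho i * rho j) ^+ 2 = 1).

Definition intersection_property (r : nat) (rho : nat -> gT) : Prop :=
  forall J K : {set 'I_r}, subgen rho J :&: subgen rho K = subgen rho (J :&: K).

Definition is_string_C_group (r : nat) (rho : nat -> gT) : Prop :=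
  is_sggi r rho /\ intersection_property r rho.

Definition schlafli_type (r : nat) (rho : nat -> gT) : seq nat :=
  [seq #[rho i.-1 * rho i] | i <- iota 1 r.-1].
End StringC.

(* an edge {a,b} with one label k is the triple (a,b,k); an edge with several
   labels is listed once per label *)
Definition edge_tperm (n a b : nat) : {perm 'I_n} :=
  match insub a, insub b with
  | Some x, Some y => tperm x y
  | _, _ => 1
  end.

Definition label_perm (n : nat) (E : seq (nat * nat * nat)) (k : nat) : {perm 'I_n} :=
  \prod_(e <- E | e.2 == k) edge_tperm n e.1.1 e.1.2.

Definition label_group (n : nat) (E : seq (nat * nat * nat)) (r : nat) : {set {perm 'I_n}} :=
  <<[set label_perm n E (val k) | k : 'I_r]>>.

(* Vertex numbering in 'I_n (L = n - 2r - 2):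
   p1 = 0, p2 = 1, p3 = 2, q_s = 3 + s (0 <= s <= L; q_0 = p4 = 3),
   y_k = L + k + 1 (2 <= k <= r+1; y_2 = q_L),
   z_k = L + r + k (3 <= k <= r+1). *)
Section Graph410.
Variables n r : nat.
Definition L410 := (n - 2 * r - 2)%N.
Definition qv (s : nat) := (3 + s)%N.
Definition yv (k : nat) := (L410 + k + 1)%N.
Definition zv (k : nat) := (L410 + r + k)%N.

Definition edges410 : seq (nat * nat * nat) :=
  [:: (0, 1, 0); (1, 2, 1); (2, 3, 0); (2, 3, 2)]%N
  ++ [seq (qv s.-1, qv s, if odd s then 1 else 0)%N | s <- iota 1 L410]
  ++ [seq (yv k, yv k.+1, k) | k <- iota 2 (r - 2)]
  ++ [:: (yv r, yv r.+1, r - 2)%N]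
  ++ [seq (zv k, zv k.+1, k) | k <- iota 3 (r - 3)]
  ++ [:: (zv r, zv r.+1, r - 2)%N]
  ++ [seq (yv j, zv j, r - 4)%N | j <- [:: r - 2; r - 1; r; r + 1]%N].
End Graph410.

Definition schlafli410 (n r : nat) : seq nat :=
  [:: n - 2 * (r - 1); 12; 6]%N ++ nseq (r - 8) 3%N ++ [:: 6; 6; 6; 4]%N.

(* Main.v *)
(* Since generators with indices at distance at least two commute, the intersection
   property reduces to intervals: <rho_0, .., rho_(b-1)> :&: <rho_a, .., rho_(r-1)> must
   lie in <rho_a, .., rho_(b-1)>.  All generators are even because n is 3 mod 4.

   The elements (rho_1 rho_2)^4 and (rho_2 rho_3)^4 are 3-cycles.  Every generator of an
   interval group containing one of them maps two of its three points among these points,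
   so the 3-cycles spread over the whole orbit and the group contains every even
   permutation of that orbit.  This gives G = A_n and the intersections with a <= 2, b >= 3;
   for b <= 2 they lie in a dihedral group, where fixing p_1 decides.

   The generators rho_k with k >= 3 commute with the exchange of y_j and z_j, so the
   interval groups with a >= 3 permute the pairs {y_j, z_j}.  Modulo <rho_a, .., rho_(b-1)>
   an element of the intersection only moves the pairs with a <= j <= b.  It then either
   preserves a choice of one point in each pair, and is a product of simultaneous
   transpositions of pairs, or is controlled by its parity; both kinds of permutations
   are realised in <rho_a, .., rho_(b-1)>. *)

Require Import Defs.
From HB Require Import structures.
From mathcomp Require Import all_boot fingroup perm morphism alt.
From mathcomp Require Import gproduct cyclic zify.
Set Implicit Arguments. Unset Strict Implicit. Unset Printing Implicit Defensive.
Local Open Scope group_scope.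

(** * Reduction of the intersection property to intervals *)

(** The index r-4 is the obstacle: besides moving the pairs r-4 and r-3, rho_(r-4) exchanges y_j and
    z_j in the four top pairs, so whether a choice of points survives depends on the interval. For b
    <= r-3 the lower group keeps the y side, and for a >= r-3 the upper group does. For a = r-4 and
    b >= r-2 the surviving choice takes z_(r-4) in place of y_(r-4). For a <= r-5 and b >= r-2 none
    survives: rho_(r-5) helps to produce the transposition of the pairs r-4 and r-3 alone, which
    strips rho_(r-4) down to its exchanges, and these yield all flips of two pairs. The interval
    with a = r-4 and b = r-3 stands apart: its group is generated by rho_(r-4) alone, and two
    invariant choices together leave no room for anything else. Case analysis takes place on vertex
    numbers in [nat], with n and r symbolic, so that linear arithmetic decides it. *)

Section IntersectionProperty.
Variables (gT : finGroupType) (r : nat) (rho : nat -> gT).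

Lemma subgenS (J K : {set 'I_r}) : J \subset K -> subgen rho J \subset subgen rho K.
Proof. by move=> JK; apply/genS/imsetS. Qed.

Lemma mem_subgen (J : {set 'I_r}) (i : 'I_r) : i \in J -> rho i \in subgen rho J.
Proof. by move=> iJ; apply/mem_gen/imset_f. Qed.

Canonical subgen_group (J : {set 'I_r}) := [group of subgen rho J].

Definition interval_set (a b : nat) : {set 'I_r} := [set i : 'I_r | a <= i < b].
Definition interval_group (a b : nat) : {set gT} := subgen rho (interval_set a b).
Canonical interval_group_group a b := [group of interval_group a b].

Hypothesis commuting : forall i j, i < r -> j < r -> i + 2 <= j -> commute (rho i) (rho j).

(** Indices below [m] and above [m] differ by at least 2, so the two parts commute elementwise and
    their join is the plain product set. *)
Lemma subgen_split (J : {set 'I_r}) (m : nat) :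
    (forall i, i \in J -> i != m :> nat) ->
  subgen rho J = subgen rho (J :&: interval_set 0 m) * subgen rho (J :&: interval_set m.+1 r).
Proof.
move=> mJ.
rewrite /subgen -cent_joinEr.
  rewrite joing_idl joing_idr joingE -imsetU -setIUr; congr <<_ @: pred_of_set _>>.
  apply/setP=> i; rewrite !inE; case iJ: (i \in J) => //=.
  by have := mJ i iJ; have := ltn_ord i; lia.
rewrite gen_subG; apply/subsetP=> _ /imsetP[i /setIP[_ im] ->].
rewrite /= cent_gen; apply/centP=> _ /imsetP[j /setIP[_ jm] ->].
apply/esym/commuting; rewrite ?ltn_ord //.
by move: im jm; rewrite !inE; lia.
Qed.

Hypothesis interval_cap : forall a b, 0 < a -> a <= b -> b < r ->
  interval_group 0 b :&: interval_group a r \subset interval_group a b.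

Lemma interval_cap_succ m1 m2 : m1 <= m2 -> m2 < r ->
  interval_group 0 m2 :&: interval_group m1.+1 r \subset interval_group m1.+1 m2.
Proof.
move=> m12 m2r; have [lt12|] := ltnP m1 m2; first exact: interval_cap.
move=> le21; have -> : m2 = m1 by lia.
case: (posnP m1) => [->|m1_gt0].
  rewrite /interval_group (_ : interval_set 0 0 = set0); first by
    rewrite /subgen imset0 gen0; apply: subset_trans (subsetIl _ _) (sub1G _).
  by apply/setP=> i; rewrite !inE; lia.
(* For [m1 = m2] the target is trivial; adding [rho m1] to the upper group brings in the hypothesis
   with [a = b]. *)
have sub1 : interval_group m1.+1 r \subset interval_group m1 r.
  by apply/subgenS/subsetP=> i; rewrite !inE; lia.
apply: subset_trans (setIS _ sub1) _.
apply: subset_trans (interval_cap _ _ _) _; rewrite ?leqnn //; first lia.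
by apply/subgenS/subsetP=> i; rewrite !inE; lia.
Qed.

(** Let [mJ <= mK] be the largest indices missing from [J] and [K]. Splitting there gives g = j u =
    k v, and j^-1 k = u v^-1 lies in the interval group strictly between [mJ] and [mK]. Hence k lies
    in the group of [J1], the part of [J] below [mJ] joined with that interval, and induction at the
    bound [mK] applies to k. The factor v is harmless because [J] contains every index between [mJ]
    and [N]. *)
Lemma subgen_cap_bounded N : N <= r -> forall J K : {set 'I_r},
    J \subset interval_set 0 N -> K \subset interval_set 0 N ->
  subgen rho J :&: subgen rho K \subset subgen rho (J :&: K).
Proof.
elim/ltn_ind: N => N IH Nr J K JN KN.
have last_missing (I : {set 'I_r}) : I \subset interval_set 0 N -> interval_set 0 N \subset I \/
    exists2 m, m < N & (forall i, i \in I -> i != m :> nat)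
             /\ interval_set m.+1 N \subset I.
  move=> IN; case: (boolP (interval_set 0 N \subset I)) => [|/subsetPn[i0]]; first by left.
  move=> i0N i0I; right.
  have PI : [pred i | (i \in interval_set 0 N) && (i \notin I)] i0 by rewrite /= i0N.
  case: (arg_maxnP (fun i : 'I_r => i : nat) PI) => /= m /andP[mN mI] mmax; exists m.
    by move: mN; rewrite inE; lia.
  split=> [i iI|]; first by apply: contraNneq mI => /val_inj <-.
  apply/subsetP=> i; rewrite inE => im; apply/negPn/negP=> iI.
  by have := mmax i; rewrite iI inE; clear - im; lia.
have [KJ|[mJ mJN [J_mJ hiJ]]] := last_missing J JN.
  by rewrite (setIidPr (subset_trans KN KJ)) subsetIr.
have [JK|[mK mKN [K_mK hiK]]] := last_missing K KN.
  by rewrite (setIidPl (subset_trans JN JK)) subsetIl.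
wlog le_m : J K mJ mK JN KN mJN mKN J_mJ hiJ K_mK hiK / mJ <= mK.
  move=> th; have [le_m|/ltnW le_m] := leqP mJ mK.
    exact: (th _ _ mJ mK).
  by rewrite setIC [J :&: K]setIC; apply: (th _ _ mK mJ).
have mKr : mK < r by apply: leq_trans Nr.
set J1 := (J :&: interval_set 0 mJ) :|: interval_set mJ.+1 mK.
have J1m : J1 \subset interval_set 0 mK.
  by rewrite /J1; apply/subsetP=> i; rewrite !inE => /orP[/andP[_]|]; lia.
have Jm : J :&: interval_set 0 mJ \subset interval_set 0 mK.
  by apply/subsetP=> i; rewrite !inE => /andP[_]; lia.
have Km : K :&: interval_set mK.+1 r \subset interval_set mJ.+1 r.
  by apply/subsetP=> i; rewrite !inE => /andP[_]; lia.
have J1K : J1 :&: (K :&: interval_set 0 mK) \subset J :&: K.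
  apply/subsetP=> i; rewrite /J1 !inE.
  case/andP=> /orP[/andP[-> _]|iJ] /andP[-> _] //; rewrite andbT.
  by apply: (subsetP hiJ); rewrite inE; lia.
have JK : K :&: interval_set mK.+1 r \subset J :&: K.
  apply/subsetP=> i; rewrite !inE; case/andP=> iK im; rewrite iK andbT.
  by apply: (subsetP hiJ); have := subsetP KN i iK; rewrite !inE; clear - im le_m mJN; lia.
apply/subsetP=> g /setIP[].
rewrite (subgen_split J_mJ) (subgen_split K_mK).
case/mulsgP=> j u jJ uJ ->; case/mulsgP=> k v kK vK juv.
have uI : u \in interval_group mJ.+1 r := subsetP (subgenS (subsetIr _ _)) u uJ.
have vI : v \in interval_group mJ.+1 r := subsetP (subgenS Km) v vK.
have jI : j \in interval_group 0 mK := subsetP (subgenS Jm) j jJ.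
have kI : k \in interval_group 0 mK := subsetP (subgenS (subsetIr _ _)) k kK.
have wI : j^-1 * k \in interval_group mJ.+1 mK.
  have jk : j^-1 * k = u * v^-1 by rewrite -[u](mulKg j) juv !mulgA mulgK.
  have /subsetP sub := interval_cap_succ le_m mKr.
  by apply: sub; apply/setIP; split; [|rewrite jk]; apply: groupM; rewrite ?groupV.
have k1 : k \in subgen rho (J1 :&: (K :&: interval_set 0 mK)).
  have /subsetP sub := IH mK mKN (ltnW mKr) _ _ J1m (subsetIr K _).
  apply: sub; apply/setIP; split=> //; rewrite -[k](mulKVg j); apply: groupM.
    exact: (subsetP (subgenS (subsetUl _ _)) j jJ).
  exact: (subsetP (subgenS (subsetUr _ _)) _ wI).
rewrite juv; apply: groupM.
  exact: (subsetP (subgenS J1K)).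
exact: (subsetP (subgenS JK)).
Qed.

Lemma intersection_property_of_intervals : intersection_property r rho.
Proof.
move=> J K; apply/eqP; rewrite eqEsubset subsetI !subgenS ?subsetIl ?subsetIr // !andbT.
by apply: (subgen_cap_bounded (leqnn r)); apply/subsetP=> i; rewrite inE ltn_ord.
Qed.

End IntersectionProperty.

(** * Even permutations generated from one 3-cycle *)

(** In the Klein four-group two double transpositions multiply to the third. This is how a product
    of two pair transpositions becomes a flip. *)
Lemma tperm4_mul (T : finType) (a b c d : T) : uniq [:: a; b; c; d] ->
  (tperm a d * tperm b c) * (tperm a c * tperm b d) = tperm a b * tperm c d.
Proof.
rewrite /= !inE !negb_or andbT => /andP[/and3P[ab ac ad] /andP[/andP[bc bd] cd]].
have tpermE x y z : tperm x y z = if z == x then y else if z == y then x else z :> T.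
  by case: tpermP => [->|->|/eqP/negbTE-> /eqP/negbTE->]; rewrite ?eqxx //; case: eqP.
have neq := (negbTE ab, negbTE ac, negbTE ad, negbTE bc, negbTE bd, negbTE cd).
have neq' := (eq_sym b a, eq_sym c a, eq_sym d a, eq_sym c b, eq_sym d b, eq_sym d c).
apply/permP=> x; rewrite !permM !tpermE.
case: (x =P a) => [_|/eqP/negbTE xa]; first by do 5! rewrite ?eqxx ?neq' ?neq /=.
case: (x =P b) => [->|/eqP/negbTE xb]; first by do 5! rewrite ?eqxx ?neq' ?neq /=.
case: (x =P c) => [->|/eqP/negbTE xc]; first by do 5! rewrite ?eqxx ?neq' ?neq /=.
case: (x =P d) => [_|/eqP/negbTE xd]; first by do 5! rewrite ?eqxx ?neq' ?neq /=.
by rewrite !(xa, xb, xc, xd).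
Qed.

Section ThreeCycles.
Variables (T : finType) (H : {group {perm T}}).
Implicit Types (S : {set T}) (g : {perm T}).

Definition cycle3 (x y z : T) : {perm T} := tperm x y * tperm x z.

Lemma cycle3J x y z g : cycle3 x y z ^ g = cycle3 (g x) (g y) (g z).
Proof. by rewrite /cycle3 conjMg !tpermJ. Qed.

Lemma cycle3V x y z : (cycle3 x y z)^-1 = cycle3 x z y.
Proof. by rewrite /cycle3 invMg !tpermV. Qed.

Lemma cycle3_rot x y z : y != z -> z != x -> cycle3 x y z = cycle3 y z x.
Proof.
move=> yz zx; rewrite /cycle3 [tperm y x]tpermC conjgCV tpermV tpermJ tpermL tpermD //.
by rewrite eq_sym.
Qed.

(** Boolean, so that a largest set with this property can be chosen. *)
Definition full3 S := [forall x in S, forall y in S, forall z in S,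
  [&& x != y, y != z & z != x] ==> (cycle3 x y z \in H)].

Lemma full3P S : reflect (forall x y z, x \in S -> y \in S -> z \in S ->
    x != y -> y != z -> z != x -> cycle3 x y z \in H) (full3 S).
Proof.
apply: (iffP forall_inP) => [fS x y z xS yS zS xy yz zx | fS x xS].
  have /forall_inP/(_ z zS)/implyP := forall_inP (fS x xS) y yS.
  by apply; rewrite xy yz.
apply/forall_inP=> y yS; apply/forall_inP=> z zS; apply/implyP=> /and3P[].
exact: fS.
Qed.

(** Induction on the size of [S]: if g moves x and [S] has a third point z, following g by the
    3-cycle through g x, x, z makes x fixed. With no third point, g is the transposition of x and g
    x, hence odd. *)
Lemma full3_even S g : full3 S -> perm_on S g -> ~~ odd_perm g -> g \in H.
Proof.
elim: {S}_.+1 {-2}S (ltnSn #|S|) g => // m IH S ltSm g fS gS g_even.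
have [g1|/existsP[x gx]] := boolP [forall x, g x == x].
  by have -> : g = 1; [apply/permP=> x; rewrite perm1; apply/eqP/(forallP g1) | exact: group1].
have xS : x \in S by apply: contraR gx => /(out_perm gS) ->.
have yS : g x \in S by rewrite (perm_closed _ gS).
have [/existsP[z /and3P[zS zx zy]] | ] := boolP [exists z in S, (z != x) && (z != g x)].
  have cH : cycle3 (g x) x z \in H.
    by apply: (full3P _ fS); rewrite // eq_sym.
  suffices : g * cycle3 (g x) x z \in H by rewrite groupMr.
  have cS : perm_on S (cycle3 (g x) x z).
    apply: perm_onM; apply: subset_trans (tperm_on _ _) _; apply/subsetP=> u;
      by rewrite !inE => /orP[]/eqP->.
  apply: (IH (S :\ x)).
  - by rewrite (cardsD1 x) xS in ltSm.
  - apply/full3P=> a b c; rewrite !inE => /andP[_ aS] /andP[_ bS] /andP[_ cS'].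
    exact: (full3P _ fS).
  - apply/subsetP=> u; rewrite !inE => gu.
    rewrite andbC (_ : u \in S).
      by apply: contraNneq gu => ->; rewrite /cycle3 !permM tpermL tpermD // eq_sym.
    by apply: contraR gu => uS; apply/eqP/(out_perm (perm_onM gS cS)).
  - by rewrite !odd_permM !odd_tperm (negbTE g_even) /= gx eq_sym zy.
rewrite negb_exists => /forallP noz; case/negP: g_even.
suffices -> : g = tperm x (g x) by rewrite odd_tperm eq_sym.
apply/eqP; rewrite -[tperm _ _]tpermV eq_mulgV1 invgK; apply/eqP.
apply: (@perm_on_id _ _ [set g x]); last by rewrite cards1.
apply/subsetP=> u; rewrite !inE permM => gu.
have [ux|ux] := eqVneq u x; first by move: gu; rewrite ux tpermR eqxx.
apply: contraR gu => uy; have := noz u; rewrite ux uy !andbT => uS.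
by rewrite (out_perm gS uS) tpermD // eq_sym.
Qed.

(* Conjugating [cycle3 x u v] by 3-cycles on [S] moves [u] and [v] to any two points of [S]. *)
Lemma full3U1 S x u v : full3 S -> u \in S -> v \in S -> u != v -> x \notin S ->
  cycle3 x u v \in H -> full3 (x |: S).
Proof.
move=> /full3P fS uS vS uv xS xuv.
have neq_x y : y \in S -> y != x by move=> yS; apply: contraNneq xS => <-.
have sym c d : cycle3 x c d \in H -> cycle3 x d c \in H by rewrite -groupV cycle3V.
have move2 c d e : c \in S -> d \in S -> e \in S -> c != d -> c != e ->
    cycle3 x c d \in H -> cycle3 x c e \in H.
  move=> cS dS eS cd ce xcd; have [<-//|de] := eqVneq d e.
  have dceH : cycle3 d c e \in H by apply: fS; rewrite // eq_sym.
  have := groupJ (sym _ _ xcd) dceH; rewrite cycle3J.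
  rewrite ![(cycle3 d c e) _]permM tpermL tpermR tpermL.
  by rewrite !(tpermD (x := d) _ _) ?neq_x // eq_sym.
have all_x c d : c \in S -> d \in S -> c != d -> cycle3 x c d \in H.
  move=> cS dS cd; have [uc|uc] := eqVneq u c; first by apply: (move2 _ v); rewrite // -uc.
  apply: (move2 _ u) => //; first by rewrite eq_sym.
  by apply/sym/(move2 _ v).
apply/full3P=> a b c; rewrite !inE.
case/predU1P=> [->|aS] /predU1P[->|bS] /predU1P[->|cS] ab bc ca; rewrite ?eqxx // in ab bc ca *.
- exact: all_x.
- by rewrite cycle3_rot // all_x.
- by rewrite -cycle3_rot ?all_x // eq_sym.
- exact: fS.
Qed.

(** Take [S] of maximal size. If h sends x out of [S], conjugating [cycle3 x u v] by h gives a
    3-cycle on h x and two points of [S], so h x could be added. This is why two of the three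
    starting points must stay among them. *)
Lemma full3_closure (X : {set {perm T}}) a b c :
    X \subset H -> cycle3 a b c \in H -> a != b -> b != c -> c != a ->
    (forall h, h \in X -> exists u v, [/\ u != v, u \in [:: a; b; c], v \in [:: a; b; c],
       h u \in [:: a; b; c] & h v \in [:: a; b; c]]) ->
  exists S, [/\ full3 S, {subset [:: a; b; c] <= S} &
    forall h x, h \in X -> x \in S -> h x \in S].
Proof.
move=> /subsetP XH abcH ab bc ca hX.
have full0 : full3 [set a; b; c].
  apply/full3P=> x y z; rewrite !inE -!orbA.
  have r1 := cycle3_rot bc ca; have r2 := cycle3_rot ca ab.
  have abc' : cycle3 a c b \in H by rewrite -cycle3V groupV.
  have r3 : cycle3 a c b = cycle3 c b a by apply: cycle3_rot; rewrite eq_sym.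
  have r4 : cycle3 c b a = cycle3 b a c by apply: cycle3_rot; rewrite // eq_sym.
  by case/or3P=> /eqP-> /or3P[]/eqP-> /or3P[]/eqP->; rewrite ?eqxx // -?r2 -?r1 -?r4 -?r3.
pose P S := full3 S && ([set a; b; c] \subset S).
have P0 : P [set a; b; c] by rewrite /P full0 subxx.
case: (arg_maxnP (fun S => #|S|) P0) => S /andP[fS /subsetP abcS] maxS.
have inS : {subset [:: a; b; c] <= S}.
  by move=> x xabc; apply: abcS; rewrite !inE -orbA in xabc *.
exists S; split=> // h x hX0 xS; apply/negPn/negP=> hxS.
have [u [v [uv uS vS huS hvS]]] := hX h hX0.
have xu : x != u by apply: contraNneq hxS => ->; apply: inS.
have vx : v != x by apply: contraNneq hxS => <-; apply: inS.
have : P (h x |: S).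
  have xuv : cycle3 x u v \in H by apply: (full3P _ fS) => //; apply: inS.
  rewrite /P (full3U1 fS (inS _ huS) (inS _ hvS) _ hxS) ?(inj_eq perm_inj) //; last first.
    by rewrite -cycle3J; apply: groupJ xuv (XH h hX0).
  by apply/subsetP=> y /abcS yS; rewrite inE yS orbT.
by move/maxS; rewrite /= cardsU1 hxS add1n /geq /= ltnn.
Qed.

End ThreeCycles.

(** * The action of the generators on the vertices *)

Ltac case_if := match goal with |- context [if ?c then _ else _] =>
  match c with context [if _ then _ else _] => fail 1 | _ =>
    let E := fresh "E" in case E: c; try (exfalso; lia) end end.
Ltac if_lia := repeat case_if; lia.
Ltac drop_lower x := match goal with H : is_true (_ < x) |- _ => clear H | _ => idtac end.
(* Locates [x] in an increasing list of points, keeping only the last lower bound. *)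
Ltac scan x v tac := let E := fresh "E" in
  case: (ltngtP x v); [move=> E; tac | drop_lower x; move=> E | drop_lower x; move=> E; tac].

Section LabelPerm.
Variable n : nat.

Definition swapn (a b x : nat) := if x == a then b else if x == b then a else x.

Lemma edge_tpermE a b (x : 'I_n) : a < n -> b < n ->
  edge_tperm n a b x = swapn a b x :> nat.
Proof.
move=> an bn; rewrite /edge_tperm !insubT /swapn.
case: tpermP => [->|->|/eqP xa /eqP xb] /=; rewrite ?eqxx //; first by case: eqP.
by rewrite -!val_eqE /= in xa xb; rewrite (negbTE xa) (negbTE xb).
Qed.

Lemma label_perm_cat E1 E2 k :
  label_perm n (E1 ++ E2) k = label_perm n E1 k * label_perm n E2 k.
Proof. exact: big_cat. Qed.

Lemma label_perm_nil k : label_perm n [::] k = 1.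
Proof. exact: big_nil. Qed.

Lemma label_perm_cons a b l E k : label_perm n ((a, b, l) :: E) k =
  (if l == k then edge_tperm n a b else 1) * label_perm n E k.
Proof. by rewrite /label_perm big_cons /=; case: eqP; rewrite ?mul1g. Qed.

Lemma label_perm_iota (F G : nat -> nat) a m k :
  label_perm n [seq (F j, G j, j) | j <- iota a m] k =
    if a <= k < a + m then edge_tperm n (F k) (G k) else 1.
Proof.
elim: m a => [|m IH] a; first by rewrite label_perm_nil addn0; case: ifP => //; lia.
rewrite /= label_perm_cons IH; case: eqP => [->|ak].
  by rewrite leqnn addnS ltnS leq_addr ltnn mulg1.
by rewrite mul1g; congr (if _ then _ else _); lia.
Qed.

Definition swap_if (c : bool) (a b x : nat) := if c then swapn a b x else x.

Lemma swap_ifF c a b x : c = false -> swap_if c a b x = x.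
Proof. by move->. Qed.

Lemma swap_ifL a b x : x = a -> swap_if true a b x = b.
Proof. by move->; rewrite /swap_if /swapn eqxx. Qed.

Lemma swap_ifR a b x : x = b -> swap_if true a b x = a.
Proof. by move->; rewrite /swap_if /swapn eqxx; case: eqP. Qed.

Lemma swap_ifD a b x : x <> a -> x <> b -> swap_if true a b x = x.
Proof. by move=> /eqP/negbTE xa /eqP/negbTE xb; rewrite /swap_if /swapn xa xb. Qed.

Lemma edge_tperm_ifE (c : bool) a b (x : 'I_n) : (c -> a < n /\ b < n) ->
  (if c then edge_tperm n a b else 1) x = swap_if c a b x :> nat.
Proof. by rewrite /swap_if; case: c => [[]// an bn|_]; rewrite ?perm1 ?edge_tpermE. Qed.

End LabelPerm.

Lemma iter_dvd (T : Type) (f : T -> T) (x : T) d m : iter d f x = x -> d %| m -> iter m f x = x.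
Proof.
move=> fx /dvdnP[q ->]; elim: q => [//|q IH].
by rewrite mulSn iterD IH.
Qed.

Lemma order_maximal (gT : finGroupType) (x : gT) m : 0 < m -> x ^+ m = 1 ->
  (forall q, q \in primes m -> x ^+ (m %/ q) != 1) -> #[x] = m.
Proof.
move=> m0 xm xq; have /dvdnP[d def_m] : #[x] %| m by rewrite order_dvdn xm.
have [d1|d_neq1] := eqVneq d 1%N; first by rewrite def_m d1 mul1n.
have d0 : 0 < d by move: m0; rewrite def_m; case: d {def_m d_neq1}.
have : prime (pdiv d) by apply: pdiv_prime; lia.
move: (pdiv d) (pdiv_dvd d) => q /dvdnP[e def_d] q_prime.
have q_m : q \in primes m.
  by rewrite mem_primes q_prime m0 def_m def_d -mulnA mulnCA dvdn_mulr.
apply: contraNeq (xq q q_m) => _.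
by rewrite def_m def_d mulnAC mulnK ?prime_gt0 // mulnC expgM expg_order expg1n eqxx.
Qed.

Section Points.
Variables (n : nat) (n_gt0 : 0 < n).

Definition point (a : nat) : 'I_n := insubd (Ordinal n_gt0) a.

Lemma val_point a : a < n -> point a = a :> nat.
Proof. by move=> an; rewrite val_insubd an. Qed.

Lemma point_val (x : 'I_n) : point x = x.
Proof. by apply/val_inj/val_point/ltn_ord. Qed.

Lemma point_eq a b : a < n -> b < n -> (point a == point b) = (a == b).
Proof. by move=> an bn; rewrite -val_eqE /= !val_point. Qed.

Lemma tperm_pointE a b (x : 'I_n) : a < n -> b < n ->
  tperm (point a) (point b) x = swapn a b x :> nat.
Proof.
move=> an bn; rewrite -edge_tpermE // /edge_tperm !insubT /point.
by congr (val (tperm _ _ _)); rewrite /insubd insubT.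
Qed.

Lemma edge_tperm_point a b : a < n -> b < n -> edge_tperm n a b = tperm (point a) (point b).
Proof. by move=> an bn; apply/permP=> x; apply/val_inj; rewrite /= tperm_pointE // edge_tpermE. Qed.

Lemma cycle3_pointE a b c (x : 'I_n) : a < n -> b < n -> c < n -> a <> b -> a <> c -> b <> c ->
  cycle3 (point a) (point b) (point c) x =
  (if x == a :> nat then b else if x == b :> nat then c else if x == c :> nat then a else x) :> nat.
Proof.
move=> an bn cn ab ac bc; rewrite permM !tperm_pointE //; move: (nat_of_ord x) => {}x.
by rewrite /swapn; repeat case_if; lia.
Qed.

End Points.

(* M is L + 1: the path p_1, p_2, p_3, q_0, .., q_L is numbered 0, .., M + 2, while
   y_k is M + k and z_k is M + r - 1 + k. *)
Section Graph.
Variables (n M r : nat).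
Hypotheses (n_gt0 : 0 < n) (M_mod : M %% 4 = 2) (M_ge : 6 <= M) (r_ge : 8 <= r)
  (n_def : n = M + 2 * r + 1).
Local Notation rho := (label_perm n (edges410 n r)).
Local Notation pt := (point n_gt0).
Local Notation G := (interval_group r rho).

(** Closed form in vertex numbers. Labels 0 and 1 alternate along the whole path 0, .., M + 2, so
    the parity of the number selects the neighbour. The tests at M + k and M + r - 1 + k serve the
    edges {y_k, y_(k+1)} and {z_k, z_(k+1)} also for k = r-2 and k = r-4, and leave only the extra
    edges to the last tests. *)
Definition act (k x : nat) : nat :=
  (  if k == 0 then (if x < M + 2 then (if odd x then x.-1 else x.+1) else x)
  else if k == 1 then (if 0 < x < M + 3 then (if odd x then x.+1 else x.-1) else x)
  else if k == 2 then
    (if x == 2 then 3 else if x == 3 then 2 else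
     if x == M + 2 then M + 3 else if x == M + 3 then M + 2 else x)
  else if x == M + k then x.+1 else if x == M + k + 1 then x.-1
  else if x == M + r - 1 + k then x.+1 else if x == M + r + k then x.-1
  else if k == r - 2 then
    (if x == M + r then x.+1 else if x == M + r + 1 then x.-1
     else if x == M + 2 * r - 1 then x.+1 else if x == M + 2 * r then x.-1 else x)
  else if k == r - 4 then
    (if M + r - 2 <= x <= M + r + 1 then x + (r - 1)
     else if M + 2 * r - 3 <= x then x - (r - 1) else x)
  else x)%N.

(** Only the part q_0, .., q_l, with a variable number l of edges for the induction. As q_0 has
    number 3, label 1 leads upwards from odd numbers and label 0 from even ones. *)
Definition path_act (l e x : nat) : nat :=
  (if (e < 2) && (3 <= x <= 3 + l) then
     (if odd x == (e == 1%N) then (if x < 3 + l then x.+1 else x)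
      else if 3 < x then x.-1 else x)
   else x)%N.

Lemma path_act_id l e x : 2 <= e -> path_act l e x = x.
Proof. by case: e => [|[|e]]. Qed.

Lemma path_label_permE l e (x : 'I_n) : 3 + l < n ->
  label_perm n [seq (qv s.-1, qv s, if odd s then 1 else 0)%N | s <- iota 1 l] e x =
    path_act l e x :> nat.
Proof.
rewrite /path_act; elim: l x => [|l IH] x ln.
  by rewrite label_perm_nil perm1; if_lia.
rewrite -[l.+1]addn1 iotaD map_cat label_perm_cat permM label_perm_cons label_perm_nil mulg1.
rewrite edge_tperm_ifE /qv; last by lia.
rewrite IH; last by lia.
clear IH; rewrite /swap_if /swapn; move: (nat_of_ord x) => {}x.
by case: e => [|[|e]]; if_lia.
Qed.

Lemma yvE k : yv n r k = (M + k)%N.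
Proof. by rewrite /yv /L410; lia. Qed.

Lemma zvE k : zv n r k = (M + r - 1 + k)%N.
Proof. by rewrite /zv /L410; lia. Qed.

Ltac swap_cond := match goal with |- context [swap_if ?c ?a ?b ?x] =>
  lazymatch c with true => fail | _ =>
    first [ rewrite (@swap_ifF c a b x); last by lia | rewrite (_ : c = true); last by lia ] end end.

(* Evaluates the innermost swap, at a point whose position is known. *)
Ltac swap_step := match goal with |- context [swap_if true ?a ?b ?x] =>
  match x with context [swap_if] => fail 1 | _ =>
    first [ rewrite (@swap_ifD a b x); [ | lia | lia ] | rewrite (@swap_ifL a b x); last by lia
          | rewrite (@swap_ifR a b x); last by lia ] end end.

Ltac decide_if E := match type of E with context [if ?c then _ else _] =>
  first [ rewrite (_ : c = false) in E; [cbv iota in E|lia]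
        | rewrite (_ : c = true) in E; [cbv iota in E|lia]
        | let F := fresh "F" in move: E; case F: c => E ] end.
Ltac eval_act := match goal with |- context [act ?k ?x] =>
  match x with context [act] => fail 1 | _ =>
    let y := fresh "y" in let E := fresh "E" in
    case: (ex_intro (fun z => act k x = z) _ erefl) => y E;
    rewrite E; rewrite /act in E; repeat decide_if E; subst y end end.

Ltac solve_act := repeat swap_step; rewrite ?/path_act /act; if_lia.

Ltac generic_point := repeat swap_step; repeat eval_act; lia.

Lemma rhoE k (x : 'I_n) : k < r -> rho k x = act k x :> nat.
Proof.
move=> kr; rewrite /edges410 !label_perm_cat !label_perm_iota /= !label_perm_cons !label_perm_nil.
rewrite !mulg1 !permM !yvE !zvE; do !rewrite edge_tperm_ifE; try by lia.
rewrite path_label_permE; last by rewrite /L410; lia.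
do !rewrite edge_tperm_ifE; try by lia.
rewrite (_ : L410 n r = M - 1)%N; last by rewrite /L410; lia.
have := ltn_ord x; rewrite {2}n_def; move: (nat_of_ord x) => {}x xn.
have [-> | [-> | [-> | [-> | [-> | [k3 [k4 k5]]]]]]] : k = 0 \/ k = 1%N \/ k = 2 \/
  k = r - 4 \/ k = r - 2 \/ 3 <= k /\ k <> r - 4 /\ k <> r - 2 by lia.
3-6: (rewrite path_act_id; last by lia).
all: repeat swap_cond.
3-6: clear M_mod n_gt0 n_def.
{ scan x 0%N solve_act. scan x 1%N solve_act. scan x 2%N solve_act. scan x 3 solve_act. solve_act. }
{ scan x 1%N solve_act. scan x 2%N solve_act. solve_act. }
{ scan x 2%N generic_point. scan x 3%N generic_point. scan x (M + 2)%N generic_point.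
  scan x (M + 3)%N generic_point. generic_point. }
{ clear kr. scan x (M + r - 4)%N generic_point. scan x (M + r - 3)%N generic_point.
  scan x (M + r - 2)%N generic_point. scan x (M + r - 1)%N generic_point.
  scan x (M + r)%N generic_point. scan x (M + r + 1)%N generic_point.
  scan x (M + 2 * r - 5)%N generic_point. scan x (M + 2 * r - 4)%N generic_point.
  scan x (M + 2 * r - 3)%N generic_point. scan x (M + 2 * r - 2)%N generic_point.
  scan x (M + 2 * r - 1)%N generic_point. scan x (M + 2 * r)%N generic_point. generic_point. }
{ clear kr. scan x (M + r - 2)%N generic_point. scan x (M + r - 1)%N generic_point.
  scan x (M + r)%N generic_point. scan x (M + r + 1)%N generic_point.
  scan x (M + 2 * r - 3)%N generic_point. scan x (M + 2 * r - 2)%N generic_point.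
  scan x (M + 2 * r - 1)%N generic_point. scan x (M + 2 * r)%N generic_point. generic_point. }
{ scan x (M + k)%N generic_point. scan x (M + k + 1)%N generic_point.
  scan x (M + r - 1 + k)%N generic_point. scan x (M + r + k)%N generic_point. generic_point. }
Qed.

(** * Supports and commutation of the generators *)

Lemma act_invol k x : k < r -> x < n -> act k (act k x) = x.
Proof.
move=> kr xn.
have [-> | [-> | [-> | [-> | [-> | [k3 [k4 k5]]]]]]] : k = 0 \/ k = 1%N \/ k = 2 \/
  k = r - 4 \/ k = r - 2 \/ 3 <= k /\ k <> r - 4 /\ k <> r - 2 by lia.
1-2: by repeat eval_act; lia.
all: clear M_mod n_gt0; repeat eval_act; lia.
Qed.

Lemma act_moved0 x : act 0 x <> x -> x < M + 2.
Proof. by rewrite /act /=; case_if. Qed.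

Lemma act_moved1 x : act 1 x <> x -> 0 < x < M + 3.
Proof. by rewrite /act /=; case_if. Qed.

Lemma act_moved k x : 3 <= k -> x < n -> act k x <> x ->
  [|| x == M + k, x == M + k + 1, x == M + r - 1 + k, x == M + r + k,
   (k == r - 2) && ((M + r <= x <= M + r + 1) || (M + 2 * r - 1 <= x)) |
   (k == r - 4) && ((M + r - 2 <= x <= M + r + 1) || (M + 2 * r - 3 <= x))]%N.
Proof.
clear M_mod n_gt0 => k3 xn; apply: contra_notT; case: k k3 => [|[|[|k]]] // _.
rewrite /act /= !negb_or => /and5P[/negbTE-> /negbTE-> /negbTE-> /negbTE->].
by case: eqP => e1; case: eqP => e2 /= H; repeat case_if; lia.
Qed.

Lemma act_fix k x : 3 <= k -> x < n -> x != M + k -> x != M + k + 1 ->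
    x != M + r - 1 + k -> x != M + r + k ->
    (k = r - 2 -> (x < M + r) || (M + r + 1 < x < M + 2 * r - 1)) ->
    (k = r - 4 -> (x < M + r - 2) || (M + r + 1 < x < M + 2 * r - 3)) ->
  act k x = x.
Proof.
move=> k3 xn x1 x2 x3 x4 x5 x6; apply/eqP/negPn/negP=> /eqP/(act_moved k3 xn).
rewrite (negbTE x1) (negbTE x2) (negbTE x3) (negbTE x4) /=.
by case/orP=> /andP[/eqP kr]; [move: (x5 kr) | move: (x6 kr)]; clear - kr xn n_def r_ge; lia.
Qed.

(** Most distant generators commute by having disjoint supports. The exceptions are 0 and 2, which
    share the edge {p_3, p_4}, and i = r-4, whose exchanges overlap the last two generators. *)
Lemma act_disjoint i j x : i + 2 <= j -> j < r -> x < n -> (i == 0) && (j == 2) = false ->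
  i != r - 4 -> act i x = x \/ act j x = x.
Proof.
move=> ij jr xn ij0 ir4.
have [|/eqP aix] := eqVneq (act i x) x; first by left.
right; apply/eqP/negPn/negP=> /eqP ajx.
have j3 : 3 <= j by clear aix ajx; lia.
move: (act_moved j3 xn ajx) => {ajx}mj.
have [i0 | [i1 | [i2 | i3]]] : i = 0 \/ i = 1%N \/ i = 2 \/ 3 <= i by lia.
- by move: aix; rewrite i0 => /act_moved0; lia.
- by move: aix; rewrite i1 => /act_moved1; lia.
- by apply: aix; clear - mj ij i2 M_ge r_ge; rewrite i2 /act /=; repeat case_if.
- by have := act_moved i3 xn aix; clear - mj ij jr ir4 i3 xn n_def r_ge; lia.
Qed.

Lemma act_lt k x : k < r -> x < n -> act k x < n.
Proof. by move=> kr xn; have := ltn_ord (rho k (Ordinal xn)); rewrite rhoE. Qed.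

(* Exchanges y_j and z_j for j >= 3, and fixes the path. *)
Definition swap_yz (x : nat) : nat :=
  if x < M + 3 then x else if x <= M + r + 1 then (x + (r - 1))%N else (x - (r - 1))%N.

Lemma swap_yz_lt x : x < n -> swap_yz x < n.
Proof. by move=> xn; rewrite /swap_yz; repeat case_if; lia. Qed.

Lemma act_swap_yz_y k x : 3 <= k -> k < r -> M + 3 <= x <= M + r + 1 ->
  act k (swap_yz x) = swap_yz (act k x).
Proof.
move=> k3 kr xM; rewrite {1}/swap_yz ifF; last lia; rewrite ifT; last lia.
by repeat eval_act; rewrite /swap_yz; repeat case_if; lia.
Qed.

Lemma act_swap_yz k x : 3 <= k -> k < r -> x < n -> act k (swap_yz x) = swap_yz (act k x).
Proof.
move=> k3 kr xn; have [xM|xM] := ltnP x (M + 3).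
  by rewrite {1}/swap_yz xM act_fix; rewrite ?/swap_yz ?xM; lia.
have [xy|xz] := leqP x (M + r + 1); first by apply: act_swap_yz_y; rewrite ?xM.
(* The z side reduces to the y side, because [swap_yz] is an involution off the path. *)
have [y [yM def_x]] : exists y, M + 3 <= y <= M + r + 1 /\ x = swap_yz y.
  by exists (x - (r - 1))%N; rewrite /swap_yz; repeat case_if; lia.
have [yn ay] : y < n /\ M + 3 <= act k y by split; [lia | repeat eval_act; lia].
have invol z : M + 3 <= z -> z < n -> swap_yz (swap_yz z) = z.
  by move=> zM zn; rewrite /swap_yz; repeat case_if; lia.
have yM1 : M + 3 <= y by case/andP: yM.
by rewrite def_x (invol y) // (act_swap_yz_y k3 kr yM) (invol (act k y)) ?act_lt.
Qed.

Definition top_block : pred nat := fun x =>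
  (M + r - 2 <= x <= M + r + 1) || (M + 2 * r - 3 <= x)%N.

Lemma act_top_block j x : r - 2 <= j -> j < r -> x < n -> top_block x -> top_block (act j x).
Proof. by rewrite /top_block; clear M_mod n_gt0 => jr2 jr xn xB; repeat eval_act; lia. Qed.

Lemma act_r4_block x : x < n -> top_block x -> act (r - 4) x = swap_yz x.
Proof.
by rewrite /top_block /swap_yz; clear M_mod n_gt0 => xn xB; repeat eval_act; repeat case_if; lia.
Qed.

Lemma act_r4_out x : x < n -> ~~ top_block x -> ~~ top_block (act (r - 4) x).
Proof. by rewrite /top_block; clear M_mod n_gt0 => xn xB; repeat eval_act; lia. Qed.

(** On [top_block] rho_(r-4) is [swap_yz], which commutes with rho_j; elsewhere rho_j is the
    identity, and rho_(r-4) preserves the complement. *)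
Lemma act_comm_top j x : r - 2 <= j -> j < r -> x < n ->
  act (r - 4) (act j x) = act j (act (r - 4) x).
Proof.
move=> jr2 jr xn; have r4 : r - 4 < r by clear - r_ge; lia.
have j3 : 3 <= j by clear - r_ge jr2; lia.
have [xB|xB] := boolP (top_block x).
  by rewrite !act_r4_block ?act_lt ?act_top_block // act_swap_yz.
have out y : y < n -> ~~ top_block y -> act j y = y.
  by rewrite /top_block => yn yB; apply: act_fix; clear - j3 jr2 jr r_ge yn yB n_def; lia.
by rewrite !out ?act_lt ?act_r4_out.
Qed.

Lemma act_comm i j x : i + 2 <= j -> j < r -> x < n -> act i (act j x) = act j (act i x).
Proof.
move=> ij jr xn.
have [[-> ->]|ij0] : (i = 0 /\ j = 2) \/ (i == 0) && (j == 2) = false by lia.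
  by repeat eval_act; lia.
have [i_r4|ir4] : i = r - 4 \/ i != r - 4 by lia.
  by rewrite i_r4; apply: act_comm_top => //; lia.
have ir : i < r by lia.
have [aix|ajx] := act_disjoint ij jr xn ij0 ir4.
  rewrite aix; have [//|] := act_disjoint ij jr (act_lt jr xn) ij0 ir4.
  by rewrite act_invol // => <-.
rewrite ajx; have [|//] := act_disjoint ij jr (act_lt ir xn) ij0 ir4.
by rewrite act_invol // => <-.
Qed.

Lemma rho_invol k : k < r -> rho k * rho k = 1.
Proof.
by move=> kr; apply/permP=> x; apply/val_inj; rewrite permM perm1 /= !rhoE // act_invol.
Qed.

Lemma rho_comm i j : i < r -> j < r -> i + 2 <= j -> commute (rho i) (rho j).
Proof.
move=> ir jr ij; apply/permP=> x; apply/val_inj.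
by rewrite !permM /= !rhoE // (act_comm ij).
Qed.

Lemma rho_neq1 k : k < r -> rho k != 1.
Proof.
move=> kr; have [kn1 kn2] : (if k < 2 then k else M + k)%N < n /\ k < n by case: ifP; lia.
apply: contraTneq isT => rk1; have := rhoE (Ordinal kn1) kr; rewrite rk1 perm1 /=.
move/esym/eqP; rewrite /act; case: ifP => k2.
  by case: k k2 {kr rk1 kn1 kn2} => [|[|//]] _ /=; if_lia.
by repeat case_if; lia.
Qed.

Lemma rho_sggi : is_sggi r rho.
Proof.
split=> [i ir|i j ir jr ij]; first by apply: nt_prime_order; rewrite ?rho_neq1 // expgS expg1 rho_invol.
rewrite expgMn; last exact: rho_comm.
by rewrite !expgS !expg0 !mulg1 !rho_invol // mulg1.
Qed.

(** * The orders of the products of consecutive generators *)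

Definition step (i j x : nat) : nat := act j (act i x).
Arguments step : simpl never.

Lemma pair_powE i j m (x : 'I_n) : i < r -> j < r ->
  ((rho i * rho j) ^+ m) x = iter m (step i j) x :> nat.
Proof.
move=> ir jr; elim: m => [|m IH]; first by rewrite perm1.
by rewrite expgSr iterS -IH !permM !rhoE.
Qed.

Lemma order_pair i j m : i < r -> j < r -> 0 < m ->
    (forall x, x < n -> iter m (step i j) x = x) ->
    (forall q, q \in primes m -> exists2 x, x < n & iter (m %/ q) (step i j) x <> x) ->
  #[rho i * rho j] = m.
Proof.
move=> ir jr m0 xm xq; apply: order_maximal => // [|q qm].
  by apply/permP=> x; apply/val_inj; rewrite /= pair_powE // perm1 xm.
have [x xn] := xq q qm; apply: contra_not_neq => p1.
by have := pair_powE (m %/ q) (Ordinal xn) ir jr; rewrite p1 perm1.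
Qed.

Ltac step_eval := rewrite /step; repeat eval_act; lia.
Ltac period d := apply: (@iter_dvd _ _ _ d).

Ltac step_rewrite := repeat match goal with
  H : step _ _ ?a = _ |- context [step _ _ ?a] => rewrite H end.
Ltac clear_steps := repeat match goal with H : step _ _ _ = _ |- _ => clear H end.
Ltac leaf x := idtac; match goal with E : x = _ |- _ => rewrite E /=; step_rewrite; reflexivity
  | _ => clear_steps; clear M_mod n_gt0; period 1%N => //; rewrite /= /step;
      do 2 (match goal with |- context [act ?i x] =>
      rewrite (@act_fix i x); [ | lia ..] end); reflexivity end.
Ltac scan_step x v := scan x v ltac:(leaf x).

Lemma order_generic k : 3 <= k -> k + 1 < r - 4 -> #[rho k * rho k.+1] = 3.
Proof.
move=> k3 kr.
have s1 : step k k.+1 (M + k) = (M + k + 2)%N by step_eval.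
have s2 : step k k.+1 (M + k + 2) = (M + k + 1)%N by step_eval.
have s3 : step k k.+1 (M + k + 1) = (M + k)%N by step_eval.
have s4 : step k k.+1 (M + r - 1 + k) = (M + r + 1 + k)%N by step_eval.
have s5 : step k k.+1 (M + r + 1 + k) = (M + r + k)%N by step_eval.
have s6 : step k k.+1 (M + r + k) = (M + r - 1 + k)%N by step_eval.
apply: order_pair => // [||x xn|q]; try lia.
  scan_step x (M + k)%N.
  scan_step x (M + k + 1)%N.
  scan_step x (M + k + 2)%N.
  scan_step x (M + r - 1 + k)%N.
  scan_step x (M + r + k)%N.
  scan_step x (M + r + 1 + k)%N.
  leaf x.
by move/(allP (isT : all (pred1 3) (primes 3)))/eqP->; exists (M + k)%N; rewrite /= ?s1; lia.
Qed.

(** Two 3-cycles on the pairs r-5, r-4, r-3, and the exchanges of the four top pairs. *)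
Lemma order_r5 : #[rho (r - 5) * rho (r - 4)] = 6.
Proof.
have s1 : step (r - 5) (r - 4) (M + r - 5) = (M + r - 3)%N by step_eval.
have s2 : step (r - 5) (r - 4) (M + r - 3) = (M + r - 4)%N by step_eval.
have s3 : step (r - 5) (r - 4) (M + r - 4) = (M + r - 5)%N by step_eval.
have s4 : step (r - 5) (r - 4) (M + 2 * r - 6) = (M + 2 * r - 4)%N by step_eval.
have s5 : step (r - 5) (r - 4) (M + 2 * r - 4) = (M + 2 * r - 5)%N by step_eval.
have s6 : step (r - 5) (r - 4) (M + 2 * r - 5) = (M + 2 * r - 6)%N by step_eval.
have sy x : M + r - 2 <= x <= M + r + 1 -> step (r - 5) (r - 4) x = (x + (r - 1))%N.
  by move=> x_in; step_eval.
have sz x : M + 2 * r - 3 <= x < n -> step (r - 5) (r - 4) x = (x - (r - 1))%N.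
  by move=> x_in; step_eval.
apply: order_pair => // [||x xn|q]; try lia.
  have [x1|x1] := boolP (M + r - 2 <= x <= M + r + 1).
    by period 2 => //; rewrite /= (sy x) ?sz; lia.
  have [x2|x2] := boolP (M + 2 * r - 3 <= x).
    by period 2 => //; rewrite /= (sz x) ?sy; lia.
  scan_step x (M + r - 5)%N.
  scan_step x (M + r - 4)%N.
  scan_step x (M + r - 3)%N.
  scan_step x (M + 2 * r - 6)%N.
  scan_step x (M + 2 * r - 5)%N.
  scan_step x (M + 2 * r - 4)%N.
  leaf x.
move/(allP (isT : all [in [:: 2; 3]] (primes 6))); rewrite !inE => /orP[]/eqP->.
  exists (M + r - 2)%N; first lia.
  have t1 : step (r - 5) (r - 4) (M + r - 2) = (M + 2 * r - 3)%N by rewrite sy; lia.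
  have t2 : step (r - 5) (r - 4) (M + 2 * r - 3) = (M + r - 2)%N by rewrite sz; lia.
  by rewrite (_ : 6 %/ 2 = 3)%N //= t1 t2 t1; lia.
exists (M + r - 5)%N; first lia.
by rewrite (_ : 6 %/ 3 = 2)%N //=; step_rewrite; lia.
Qed.

(** A 6-cycle running through both points of the pairs r-4, r-3, r-2, and the exchanges of the three
    remaining pairs. *)
Lemma order_r4 : #[rho (r - 4) * rho (r - 3)] = 6.
Proof.
have s1 : step (r - 4) (r - 3) (M + r - 4) = (M + r - 2)%N by step_eval.
have s2 : step (r - 4) (r - 3) (M + r - 2) = (M + 2 * r - 4)%N by step_eval.
have s3 : step (r - 4) (r - 3) (M + 2 * r - 4) = (M + 2 * r - 5)%N by step_eval.
have s4 : step (r - 4) (r - 3) (M + 2 * r - 5) = (M + 2 * r - 3)%N by step_eval.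
have s5 : step (r - 4) (r - 3) (M + 2 * r - 3) = (M + r - 3)%N by step_eval.
have s6 : step (r - 4) (r - 3) (M + r - 3) = (M + r - 4)%N by step_eval.
have sy x : M + r - 1 <= x <= M + r + 1 -> step (r - 4) (r - 3) x = (x + (r - 1))%N.
  by move=> x_in; step_eval.
have sz x : M + 2 * r - 2 <= x < n -> step (r - 4) (r - 3) x = (x - (r - 1))%N.
  by move=> x_in; step_eval.
apply: order_pair => // [||x xn|q]; try lia.
  have [x1|x1] := boolP (M + r - 1 <= x <= M + r + 1).
    by period 2 => //; rewrite /= (sy x) ?sz; lia.
  have [x2|x2] := boolP (M + 2 * r - 2 <= x).
    by period 2 => //; rewrite /= (sz x) ?sy; lia.
  scan_step x (M + r - 4)%N.
  scan_step x (M + r - 3)%N.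
  scan_step x (M + r - 2)%N.
  scan_step x (M + 2 * r - 5)%N.
  scan_step x (M + 2 * r - 4)%N.
  scan_step x (M + 2 * r - 3)%N.
  leaf x.
move/(allP (isT : all [in [:: 2; 3]] (primes 6))); rewrite !inE => /orP[]/eqP->.
  exists (M + r - 4)%N; first lia.
  by rewrite (_ : 6 %/ 2 = 3)%N //=; step_rewrite; lia.
exists (M + r - 4)%N; first lia.
by rewrite (_ : 6 %/ 3 = 2)%N //=; step_rewrite; lia.
Qed.

(** Two 3-cycles on the pairs r-3, r-2, r-1; the second edges with label r-2 contribute the
    transpositions that make the order even. *)
Lemma order_r3 : #[rho (r - 3) * rho (r - 2)] = 6.
Proof.
have s1 : step (r - 3) (r - 2) (M + r - 3) = (M + r - 1)%N by step_eval.
have s2 : step (r - 3) (r - 2) (M + r - 1) = (M + r - 2)%N by step_eval.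
have s3 : step (r - 3) (r - 2) (M + r - 2) = (M + r - 3)%N by step_eval.
have s4 : step (r - 3) (r - 2) (M + 2 * r - 4) = (M + 2 * r - 2)%N by step_eval.
have s5 : step (r - 3) (r - 2) (M + 2 * r - 2) = (M + 2 * r - 3)%N by step_eval.
have s6 : step (r - 3) (r - 2) (M + 2 * r - 3) = (M + 2 * r - 4)%N by step_eval.
have t1 : step (r - 3) (r - 2) (M + r) = (M + r + 1)%N by step_eval.
have t2 : step (r - 3) (r - 2) (M + r + 1) = (M + r)%N by step_eval.
have t3 : step (r - 3) (r - 2) (M + 2 * r - 1) = (M + 2 * r)%N by step_eval.
have t4 : step (r - 3) (r - 2) (M + 2 * r) = (M + 2 * r - 1)%N by step_eval.
apply: order_pair => // [||x xn|q]; try lia.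
  scan_step x (M + r - 3)%N.
  scan_step x (M + r - 2)%N.
  scan_step x (M + r - 1)%N.
  scan_step x (M + r)%N.
  scan_step x (M + r + 1)%N.
  scan_step x (M + 2 * r - 4)%N.
  scan_step x (M + 2 * r - 3)%N.
  scan_step x (M + 2 * r - 2)%N.
  scan_step x (M + 2 * r - 1)%N.
  scan_step x (M + 2 * r)%N.
  leaf x.
move/(allP (isT : all [in [:: 2; 3]] (primes 6))); rewrite !inE => /orP[]/eqP->.
  exists (M + r)%N; first lia.
  by rewrite (_ : 6 %/ 2 = 3)%N //=; step_rewrite; lia.
exists (M + r - 3)%N; first lia.
by rewrite (_ : 6 %/ 3 = 2)%N //=; step_rewrite; lia.
Qed.

Lemma order_r2 : #[rho (r - 2) * rho (r - 1)] = 4.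
Proof.
have s1 : step (r - 2) (r - 1) (M + r - 2) = (M + r)%N by step_eval.
have s2 : step (r - 2) (r - 1) (M + r) = (M + r + 1)%N by step_eval.
have s3 : step (r - 2) (r - 1) (M + r + 1) = (M + r - 1)%N by step_eval.
have s4 : step (r - 2) (r - 1) (M + r - 1) = (M + r - 2)%N by step_eval.
have t1 : step (r - 2) (r - 1) (M + 2 * r - 3) = (M + 2 * r - 1)%N by step_eval.
have t2 : step (r - 2) (r - 1) (M + 2 * r - 1) = (M + 2 * r)%N by step_eval.
have t3 : step (r - 2) (r - 1) (M + 2 * r) = (M + 2 * r - 2)%N by step_eval.
have t4 : step (r - 2) (r - 1) (M + 2 * r - 2) = (M + 2 * r - 3)%N by step_eval.
apply: order_pair => // [||x xn|q]; try lia.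
  scan_step x (M + r - 2)%N.
  scan_step x (M + r - 1)%N.
  scan_step x (M + r)%N.
  scan_step x (M + r + 1)%N.
  scan_step x (M + 2 * r - 3)%N.
  scan_step x (M + 2 * r - 2)%N.
  scan_step x (M + 2 * r - 1)%N.
  scan_step x (M + 2 * r)%N.
  leaf x.
move/(allP (isT : all (pred1 2) (primes 4)))/eqP->.
exists (M + r - 2)%N; first lia.
by rewrite (_ : 4 %/ 2 = 2)%N //=; step_rewrite; lia.
Qed.

Ltac low_leaf x := idtac; match goal with E : x = _ |- _ => rewrite E /=; step_rewrite; reflexivity
  | _ => clear_steps; period 2 => //; rewrite /=; step_eval end.
Ltac scan_low x v := scan x v ltac:(low_leaf x).

Lemma steps12 : [/\ step 1 2 1 = 3, step 1 2 3 = 4, step 1 2 4 = 2 & step 1 2 2 = 1%N].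
Proof. by split; step_eval. Qed.

Lemma steps12_top : [/\ step 1 2 (M + 1) = (M + 3)%N, step 1 2 (M + 3) = (M + 2)%N &
  step 1 2 (M + 2) = (M + 1)%N].
Proof. by split; step_eval. Qed.

Lemma steps23 : step 2 3 2 = 3 /\ step 2 3 3 = 2.
Proof. by split; step_eval. Qed.

Lemma steps23_y : [/\ step 2 3 (M + 2) = (M + 4)%N, step 2 3 (M + 4) = (M + 3)%N &
  step 2 3 (M + 3) = (M + 2)%N].
Proof. by split; step_eval. Qed.

Lemma steps23_z : step 2 3 (M + r + 2) = (M + r + 3)%N /\ step 2 3 (M + r + 3) = (M + r + 2)%N.
Proof. by split; step_eval. Qed.

(** A 3-cycle on y_2, y_3, y_4 and the transpositions of p_3, p_4 and of z_3, z_4. *)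
Lemma order_23 : #[rho 2 * rho 3] = 6.
Proof.
have [[[s1 s2] [s3 s4 s5]] [s6 s7]] := (steps23, steps23_y, steps23_z).
apply: order_pair => // [||x xn|q]; try lia.
  scan_low x 2. scan_low x 3. scan_low x (M + 2)%N. scan_low x (M + 3)%N.
  scan_low x (M + 4)%N. scan_low x (M + r + 2)%N. scan_low x (M + r + 3)%N.
  low_leaf x.
move/(allP (isT : all [in [:: 2; 3]] (primes 6))); rewrite !inE => /orP[]/eqP->.
  exists 2; first lia.
  by rewrite (_ : 6 %/ 2 = 3)%N //=; step_rewrite.
exists (M + 2)%N; first lia.
by rewrite (_ : 6 %/ 3 = 2)%N //=; step_rewrite; lia.
Qed.

(** A 4-cycle on p_2, p_4, q_1, p_3, a 3-cycle on q_(L-1), q_L, y_3, and transpositions along the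
    rest of the path. [M_ge] keeps the two ends of the path apart. *)
Lemma order_12 : #[rho 1 * rho 2] = 12.
Proof.
have [[s1 s2 s3 s4] [s5 s6 s7]] := (steps12, steps12_top).
apply: order_pair => // [||x xn|q]; try lia.
  scan_low x 1%N. scan_low x 2. scan_low x 3. scan_low x 4. scan_low x (M + 1)%N.
  scan_low x (M + 2)%N. scan_low x (M + 3)%N.
  low_leaf x.
move/(allP (isT : all [in [:: 2; 3]] (primes 12))); rewrite !inE => /orP[]/eqP->.
  exists 1%N; first lia.
  by rewrite (_ : 12 %/ 2 = 6)%N //=; step_rewrite.
exists (M + 1)%N; first lia.
by rewrite (_ : 12 %/ 3 = 4)%N //=; step_rewrite; lia.
Qed.

Ltac low_leaf4 x := idtac; match goal with E : x = _ |- _ => rewrite E /=; step_rewrite; if_lia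
  | _ => clear_steps; rewrite (_ : iter 4 _ x = x); [if_lia | period 2 => //; rewrite /=; step_eval] end.
Ltac scan_low4 x v := scan x v ltac:(low_leaf4 x).

(** The fourth power kills 4-cycles and transpositions and leaves a 3-cycle unchanged. *)
Lemma cycle3_23 : (rho 2 * rho 3) ^+ 4 = cycle3 (pt (M + 2)) (pt (M + 4)) (pt (M + 3)).
Proof.
have [[[s1 s2] [s3 s4 s5]] [s6 s7]] := (steps23, steps23_y, steps23_z).
apply/permP=> x0; apply/val_inj; rewrite [LHS]pair_powE; try lia.
rewrite [RHS]cycle3_pointE; try lia.
have := ltn_ord x0; move: (nat_of_ord x0) => x xn {x0}.
scan_low4 x 2. scan_low4 x 3. scan_low4 x (M + 2)%N. scan_low4 x (M + 3)%N.
scan_low4 x (M + 4)%N. scan_low4 x (M + r + 2)%N. scan_low4 x (M + r + 3)%N.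
low_leaf4 x.
Qed.

Lemma cycle3_12 : (rho 1 * rho 2) ^+ 4 = cycle3 (pt (M + 1)) (pt (M + 3)) (pt (M + 2)).
Proof.
have [[s1 s2 s3 s4] [s5 s6 s7]] := (steps12, steps12_top).
apply/permP=> x0; apply/val_inj; rewrite [LHS]pair_powE; try lia.
rewrite [RHS]cycle3_pointE; try lia.
have := ltn_ord x0; move: (nat_of_ord x0) => x xn {x0}.
scan_low4 x 1%N. scan_low4 x 2. scan_low4 x 3. scan_low4 x 4. scan_low4 x (M + 1)%N.
scan_low4 x (M + 2)%N. scan_low4 x (M + 3)%N.
low_leaf4 x.
Qed.

(* Position of the vertex [x] of the path p1, .., q_L along the cycle of [rho 0 * rho 1]. *)
Definition path_pos (x : nat) : nat := (if odd x then M + 3 - (x.+1)./2 else x./2)%N.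

Lemma path_pos_step x : x < M + 3 -> step 0 1 x < M + 3 /\
  path_pos (step 0 1 x) = (if path_pos x == M + 2 then 0 else (path_pos x).+1).
Proof. by move=> xM; rewrite /path_pos /step; repeat eval_act; if_lia. Qed.

Lemma path_pos_inj x y : x < M + 3 -> y < M + 3 -> path_pos x = path_pos y -> x = y.
Proof. by move=> xM yM; rewrite /path_pos; repeat case_if; lia. Qed.

Lemma path_pos_iter i x : x < M + 3 -> iter i (step 0 1) x < M + 3 /\
  path_pos (iter i (step 0 1) x) = (path_pos x + i) %% (M + 3).
Proof.
move=> xM; elim: i => [|i [IH1 IH2]].
  by split=> //; rewrite addn0 modn_small //= /path_pos; if_lia.
have [-> ->] := path_pos_step IH1; split=> //; rewrite IH2.
rewrite -[i.+1]addn1 addnA -(modnDml (path_pos x + i)).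
have : (path_pos x + i) %% (M + 3) < M + 3 by rewrite ltn_pmod //; lia.
move: (_ %% _) => t tM; case: eqP => [->|tM2]; first by rewrite -addnA modnn.
by rewrite modn_small; lia.
Qed.

Lemma path_iter_fix x : x < n -> iter (M + 3) (step 0 1) x = x.
Proof.
move=> xn; have [xM|xM] := ltnP x (M + 3).
  have [ltM pos] := path_pos_iter (M + 3) xM; apply: path_pos_inj => //.
  by rewrite pos modnDr modn_small // /path_pos; if_lia.
by apply: (@iter_dvd _ _ _ 1%N) => //=; step_eval.
Qed.

Lemma path_iter0 i : iter i (step 0 1) 0 = 0 -> M + 3 %| i.
Proof.
have xM : 0 < M + 3 by lia.
by have [_] := path_pos_iter i xM => /[swap] -> /=; rewrite /path_pos /= add0n /dvdn => <-.
Qed.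

(** On the path the product is a single cycle through all M + 3 vertices, so p_1 alone detects the
    order; off the path it is the identity. *)
Lemma order_01 : #[rho 0 * rho 1] = M + 3.
Proof.
apply: order_pair => // [|||x xn|q]; try lia; first exact: path_iter_fix.
rewrite mem_primes => /and3P[q_prime _ q_dvd]; exists 0 => //.
move/path_iter0/dvdn_leq; have := prime_gt1 q_prime; have := divn_gt0 (M + 3) (prime_gt0 q_prime).
rewrite dvdn_leq //; last lia.
have := ltn_Pdiv (prime_gt1 q_prime) (_ : 0 < M + 3); lia.
Qed.

Lemma schlafli_typeE : schlafli_type r rho = schlafli410 n r.
Proof.
rewrite /schlafli_type /schlafli410.
(* Entry i is the order of rho_(i-1) rho_i, so [order_generic] covers the positions 4, .., r-5. *)
have -> : iota 1 r.-1 = [:: 1; 2; 3]%N ++ iota 4 (r - 8) ++ [:: r - 4; r - 3; r - 2; r - 1]%N.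
  rewrite (_ : r.-1 = 3 + ((r - 8) + 4))%N; last lia.
  rewrite !iotaD /=; congr [:: _, _, _ & _ ++ _].
  by congr [:: _; _; _; _]; lia.
have [o5 [o4 [o3 o2]]] := (order_r5, (order_r4,
  (order_r3, order_r2))).
rewrite !map_cat /= order_01 order_12
  order_23.
congr [:: _, _, _ & _ ++ _]; first lia.
  apply: (@eq_from_nth _ 0); first by rewrite size_map size_iota size_nseq.
  move=> i; rewrite size_map size_iota => ri.
  rewrite (nth_map 0) ?size_iota // nth_iota // nth_nseq ri.
  by rewrite [(4 + i)%N]addSn /= order_generic; lia.
rewrite (_ : (r - 4).-1 = r - 5)%N; last lia; rewrite (_ : (r - 3).-1 = r - 4)%N; last lia.
rewrite (_ : (r - 2).-1 = r - 3)%N; last lia; rewrite (_ : (r - 1).-1 = r - 2)%N; last lia.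
by rewrite o5 o4 o3 o2.
Qed.

(** * Parity of the generators *)

Lemma odd_edge_if (c : bool) a b : (c -> [/\ a < n, b < n & a <> b]) ->
  odd_perm (if c then edge_tperm n a b else 1) = c.
Proof.
case: c => [[]// an bn /eqP ab|_]; last exact: odd_perm1.
by rewrite (edge_tperm_point n_gt0) // odd_tperm point_eq // ab.
Qed.

Lemma odd_path l e : 3 + l < n ->
  odd_perm (label_perm n [seq (qv s.-1, qv s, if odd s then 1 else 0)%N | s <- iota 1 l] e) =
  odd (if e == 1%N then uphalf l else if e == 0 then l./2 else 0).
Proof.
elim: l => [|l IH] ln; first by rewrite label_perm_nil odd_perm1; repeat case: ifP.
rewrite -[l.+1]addn1 iotaD map_cat label_perm_cat odd_permM label_perm_cons label_perm_nil mulg1.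
rewrite odd_edge_if /qv; last by move=> _; split; lia.
rewrite IH; last by lia.
by clear IH; case: e => [|[|e]] /=; if_lia.
Qed.

Ltac decide_bool c := first [ rewrite (_ : c = false); last by lia
                            | rewrite (_ : c = true); last by lia ].

(** The path has M + 2 edges with alternating labels, so rho_0 and rho_1 have (M + 2)/2
    transpositions each, an even number since M is 2 mod 4. The others have 2, except rho_(r-2) with
    4 and rho_(r-4) with 6. *)
Lemma odd_rho k : k < r -> odd_perm (rho k) = false.
Proof.
move=> kr; rewrite /edges410 !label_perm_cat !label_perm_iota /= !label_perm_cons !label_perm_nil.
rewrite !mulg1 !odd_permM !yvE !zvE.
rewrite !odd_edge_if; try by move=> *; split; lia.
rewrite odd_path; last by rewrite /L410; lia.
rewrite (_ : L410 n r = M - 1)%N; last by rewrite /L410; lia.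
have [-> | [-> | [-> | [-> | [-> | [k3 [k4 k5]]]]]]] : k = 0 \/ k = 1%N \/ k = 2 \/
  k = r - 4 \/ k = r - 2 \/ 3 <= k /\ k <> r - 4 /\ k <> r - 2 by lia.
all: repeat match goal with
  | |- context [?a == ?b] => decide_bool (a == b)
  | |- context [?a && ?b] => decide_bool (a && b) end.
all: rewrite /= ?addbF //; lia.
Qed.

Lemma odd_interval a b g : g \in interval_group r rho a b -> odd_perm g = false.
Proof.
move=> gG; suffices /subsetP sub : interval_group r rho a b \subset 'Alt_('I_n).
  by have := sub g gG; rewrite Alt_even => /negbTE.
rewrite gen_subG; apply/subsetP=> _ /imsetP[k _ ->].
by rewrite Alt_even odd_rho ?ltn_ord.
Qed.

(** * The interval groups *)

Lemma mem_interval a b k : a <= k < b -> k < r -> rho k \in G a b.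
Proof. by move=> ab kr; apply: (@mem_subgen _ _ _ _ (Ordinal kr)); rewrite inE. Qed.

Lemma interval_ind a b (P : {perm 'I_n} -> Prop) : P 1 ->
    (forall g h, P g -> P h -> P (g * h)) -> (forall k, k < r -> a <= k < b -> P (rho k)) ->
  forall g, g \in G a b -> P g.
Proof.
move=> P1 PM Prho g /gen_prodgP[m [c cG ->]]; elim/big_ind: _ => // i _.
by have /imsetP[k] := cG i; rewrite inE => kab ->; apply: Prho (ltn_ord k) kab.
Qed.

Lemma rho_pt k x : k < r -> x < n -> rho k (pt x) = pt (act k x).
Proof.
move=> kr xn; apply/val_inj; rewrite /= rhoE // !val_point //.
exact: act_lt.
Qed.

Definition supported (P : pred nat) (g : {perm 'I_n}) := forall x : 'I_n, ~~ P x -> g x = x.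
Definition stabilizes (P : pred nat) (g : {perm 'I_n}) := forall x : 'I_n, P x -> P (g x).

(* The orbit of q_L under the interval group from a to b, for a <= 2 and b >= 3. *)
Definition region (a b : nat) : pred nat := fun x =>
  ((if a == 0 then 0 else M + a) <= x) &&
  [|| b == r, x <= M + b | (r - 2 <= b) && (M + r + 2 <= x <= M + r - 1 + b)]%N.

Section RegionReach.
Variables (a b : nat) (S : {set 'I_n}).
Hypotheses (a_le : a <= 2) (b_gt : a < b) (b_ge : 3 <= b) (b_le : b <= r).
Hypotheses (S_closed : forall k x, a <= k < b -> x < n -> pt x \in S -> pt (act k x) \in S).
Hypotheses (S1 : a <= 1 -> pt (M + 1) \in S) (S2 : pt (M + 2) \in S).

Let move_to k x y : pt x \in S -> x < n -> a <= k < b -> act k x = y -> pt y \in S.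
Proof. by move=> xS xn kab <-; apply: S_closed. Qed.

Lemma reach_path i : a = 0 -> i <= M + 1 -> pt (M + 1 - i) \in S.
Proof.
move=> a0; elim: i => [|i IH] iM; first by rewrite subn0 S1 ?a0.
have [o|o] := boolP (odd (M + 1 - i)).
  by apply: (move_to (k := 0) (IH _)); try lia; repeat eval_act; lia.
by apply: (move_to (k := 1) (IH _)); try lia; repeat eval_act; lia.
Qed.

Lemma reach_y i : i + 2 <= b -> pt (M + 2 + i) \in S.
Proof.
elim: i => [|i IH] ib; first by rewrite addn0.
apply: (move_to (k := i + 2) (IH _)); try lia.
by have [i0|i0] := posnP i; [rewrite i0; repeat eval_act; lia | repeat eval_act; lia].
Qed.

(** The lowest crossing to the z side is the edge {y_(r-2), z_(r-2)}; reaching y_(r-2) takes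
    rho_(r-3), hence the bound on b. From z_(r-2) the walk descends to z_3. *)
Lemma reach_z i : r - 2 <= b -> i + 5 <= r -> pt (M + 2 * r - 3 - i) \in S.
Proof.
move=> br; elim: i => [|i IH] ir.
  have y : pt (M + r - 2) \in S.
    by rewrite (_ : M + r - 2 = M + 2 + (r - 4))%N; [apply: reach_y|]; lia.
  by apply: (move_to (k := r - 4) y); try lia; repeat eval_act; lia.
apply: (move_to (k := r - 3 - i) (IH _)); try lia.
have [i1|i1] := eqVneq i 1%N; first by rewrite i1; repeat eval_act; lia.
by repeat eval_act; lia.
Qed.

Lemma reach_z_up k : r - 2 <= k -> k <= b -> pt (M + r - 1 + k) \in S.
Proof.
elim: k => [|k IH] rk kb; first lia.
have [k_r3|k_r3] := eqVneq k (r - 3)%N.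
  by rewrite (_ : M + r - 1 + k.+1 = M + 2 * r - 3 - 0)%N; [apply: reach_z|]; lia.
apply: (move_to (k := k) (IH _ _)); try lia.
have [k_r2|k_r2] := eqVneq k (r - 2)%N; first by rewrite k_r2; repeat eval_act; lia.
by repeat eval_act; lia.
Qed.

Lemma reach_region x : x < n -> region a b x -> pt x \in S.
Proof.
move=> xn /andP[ax xb].
have [xM|xM] := leqP x (M + 1).
  case: eqP ax => [a0 _|a0 ax].
    by rewrite (_ : x = M + 1 - (M + 1 - x))%N; [apply: reach_path|]; lia.
  by rewrite (_ : x = M + 1)%N; [apply: S1|]; lia.
have [xB|xB] := leqP x (M + b).
  by rewrite (_ : x = M + 2 + (x - (M + 2)))%N; [apply: reach_y|]; lia.
have {xb} : b == r \/ (r - 2 <= b) && (M + r + 2 <= x <= M + r - 1 + b) by lia.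
case=> [/eqP br|xz].
  have [x1|x1] := eqVneq x (M + r + 1)%N.
    have y : pt (M + r) \in S by rewrite (_ : M + r = M + 2 + (r - 2))%N; [apply: reach_y|]; lia.
    by rewrite x1; apply: (move_to (k := r - 2) y); try lia; repeat eval_act; lia.
  have [x2|x2] := eqVneq x (M + 2 * r)%N.
    have z : pt (M + r - 1 + r) \in S by apply: reach_z_up; lia.
    by rewrite x2; apply: (move_to (k := r - 2) z); try lia; repeat eval_act; lia.
  have [x3|x3] := leqP x (M + 2 * r - 3).
    by rewrite (_ : x = M + 2 * r - 3 - (M + 2 * r - 3 - x))%N; [apply: reach_z|]; lia.
  by rewrite (_ : x = M + r - 1 + (x - (M + r - 1)))%N; [apply: reach_z_up|]; lia.
have [x3|x3] := leqP x (M + 2 * r - 3).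
  by rewrite (_ : x = M + 2 * r - 3 - (M + 2 * r - 3 - x))%N; [apply: reach_z|]; lia.
by rewrite (_ : x = M + r - 1 + (x - (M + r - 1)))%N; [apply: reach_z_up|]; lia.
Qed.

End RegionReach.

Lemma closed_from_cycle3 a b c1 c2 c3 : b <= r -> c1 < n -> c2 < n -> c3 < n ->
    [/\ c1 <> c2, c2 <> c3 & c3 <> c1] ->
    cycle3 (pt c1) (pt c2) (pt c3) \in G a b ->
    (forall k, a <= k < b -> exists u v, [/\ u <> v, u \in [:: c1; c2; c3], v \in [:: c1; c2; c3],
       act k u \in [:: c1; c2; c3] & act k v \in [:: c1; c2; c3]]) ->
  exists S : {set 'I_n}, [/\ full3 (interval_group_group r rho a b) S,
    forall x, x \in [:: c1; c2; c3] -> pt x \in S &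
    forall k x, a <= k < b -> x < n -> pt x \in S -> pt (act k x) \in S].
Proof.
move=> br n1 n2 n3 [d12 d23 d31] cG two.
have lt_c x : x \in [:: c1; c2; c3] -> x < n by rewrite !inE => /or3P[]/eqP->.
have pt_c x : x \in [:: c1; c2; c3] -> pt x \in [:: pt c1; pt c2; pt c3].
  by rewrite !inE => /or3P[]/eqP->; rewrite eqxx ?orbT.
have [||||h hX|S [fS inS clS]] := @full3_closure _ (interval_group_group r rho a b)
  [set rho (val k) | k in interval_set r a b] (pt c1) (pt c2) (pt c3) _ cG.
- exact: subset_gen.
- by rewrite point_eq //; apply/eqP.
- by rewrite point_eq //; apply/eqP.
- by rewrite point_eq //; apply/eqP.
- case/imsetP: hX => k; rewrite inE => kab ->.
  have [u [v [uv u3 v3 au3 av3]]] := two k kab.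
  exists (pt u), (pt v); rewrite !rho_pt ?ltn_ord ?lt_c //.
  by split; rewrite ?point_eq ?pt_c ?lt_c //; apply/eqP.
exists S; split=> // [x x3|k x kab xn xS]; first exact/inS/pt_c.
have kr : k < r by lia.
rewrite -rho_pt //; apply: clS => //.
by apply/imsetP; exists (Ordinal kr); rewrite ?inE.
Qed.

(** The initial 3-cycle comes from rho_1 rho_2 when a <= 1 and from rho_2 rho_3 when a = 2; for a =
    2 and b = 3 neither product lies in the group. *)
Lemma full_interval a b g : (a <= 1 /\ 3 <= b) \/ (a = 2 /\ 4 <= b) -> b <= r ->
  supported (region a b) g -> odd_perm g = false -> g \in G a b.
Proof.
move=> ab br gS g_even.
have mem k : a <= k < b -> rho k \in G a b by move=> kab; apply: mem_interval; lia.
have [S [fS S1 S2 clS]] : exists S : {set 'I_n}, [/\ full3 (interval_group_group r rho a b) S,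
    a <= 1 -> pt (M + 1) \in S, pt (M + 2) \in S &
    forall k x, a <= k < b -> x < n -> pt x \in S -> pt (act k x) \in S].
  case: ab => [[a1 b3]|[a2 b4]].
    have [|||||k kab|S [fS inS clS]] := @closed_from_cycle3 a b (M + 1) (M + 3) (M + 2) br; try lia.
    + by split; lia.
    + rewrite -cycle3_12.
      by apply/groupX/groupM; apply: mem; lia.
    (* Every generator fixes or interchanges two of the points M + 1, M + 2, M + 3: the last two for
       k = 0 and k = 2, the first two otherwise. *)
    + have [k0|[k1|[k2|k3]]] : k = 0 \/ k = 1%N \/ k = 2 \/ 3 <= k by lia.
      * by exists (M + 2)%N, (M + 3)%N; rewrite k0 !inE; split; try lia; repeat eval_act; lia.
      * by exists (M + 1)%N, (M + 2)%N; rewrite k1 !inE; split; try lia; repeat eval_act; lia.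
      * by exists (M + 2)%N, (M + 3)%N; rewrite k2 !inE; split; try lia; repeat eval_act; lia.
      * by exists (M + 1)%N, (M + 2)%N; rewrite !inE; split; try lia; repeat eval_act; lia.
    by exists S; split=> // [_|]; apply: inS; rewrite !inE eqxx ?orbT.
  have [|||||k kab|S [fS inS clS]] := @closed_from_cycle3 a b (M + 2) (M + 4) (M + 3) br; try lia.
  + by split; lia.
  + rewrite -cycle3_23.
    by apply/groupX/groupM; apply: mem; lia.
  + have [k2|[k3|k4]] : k = 2 \/ k = 3 \/ 4 <= k by lia.
    * by exists (M + 2)%N, (M + 3)%N; rewrite k2 !inE; split; try lia; repeat eval_act; lia.
    * by exists (M + 3)%N, (M + 4)%N; rewrite k3 !inE; split; try lia; repeat eval_act; lia.
    * by exists (M + 2)%N, (M + 3)%N; rewrite !inE; split; try lia; repeat eval_act; lia.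
  by exists S; split=> //; [lia | apply: inS; rewrite !inE eqxx ?orbT].
apply: (full3_even fS); last by rewrite g_even.
apply/subsetP=> x; rewrite inE; apply: contraR => xS; apply/eqP/gS.
apply: contra xS => xR; rewrite -(point_val n_gt0 x).
by apply: (reach_region _ _ _ br clS S1 S2); rewrite ?ltn_ord //; clear - ab; lia.
Qed.

Lemma interval_group_full : G 0 r = 'Alt_('I_n).
Proof.
apply/setP=> g; rewrite Alt_even; apply/idP/idP => [|g_even].
  by move/odd_interval => ->.
by apply: full_interval; try lia; [move=> x /negP[]; apply/andP; rewrite /= eqxx | exact: negbTE].
Qed.

Lemma supportedM P g h : supported P g -> supported P h -> supported P (g * h).
Proof. by move=> gP hP x xP; rewrite permM gP ?hP. Qed.

Lemma supportedV P g : supported P g -> supported P g^-1.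
Proof. by move=> gP x xP; rewrite -{1}(gP x xP) permK. Qed.

Lemma supportedJ P g h : supported P g -> stabilizes P h -> supported P (g ^ h).
Proof.
move=> gP hP x xP; rewrite !permM gP ?permKV //.
by apply: contra xP => /hP; rewrite permKV.
Qed.

Lemma supportedI P Q g : supported P g -> supported Q g -> supported (fun x => P x && Q x) g.
Proof. by move=> gP gQ x; rewrite negb_and => /orP[/gP|/gQ]. Qed.

Lemma stabilizesM P g h : stabilizes P g -> stabilizes P h -> stabilizes P (g * h).
Proof. by move=> gP hP x xP; rewrite permM; apply/hP/gP. Qed.

Lemma supported_rho (P : pred nat) k : k < r ->
  (forall x, x < n -> ~~ P x -> act k x = x) -> supported P (rho k).
Proof. by move=> kr kP x xP; apply/val_inj; rewrite /= rhoE // kP. Qed.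

Lemma stabilizes_rho (P : pred nat) k : k < r ->
  (forall x, x < n -> P x -> P (act k x)) -> stabilizes P (rho k).
Proof. by move=> kr kP x xP; rewrite rhoE // kP. Qed.

Lemma supported_interval (P : pred nat) a b :
    (forall k x, k < r -> a <= k < b -> x < n -> ~~ P x -> act k x = x) ->
  forall g, g \in G a b -> supported P g.
Proof.
move=> kP; apply: interval_ind => [x _|g h|k kr kab]; first by rewrite perm1.
  exact: supportedM.
by apply: supported_rho => // x; apply: kP.
Qed.

Lemma stabilizes_interval (P : pred nat) a b :
    (forall k x, k < r -> a <= k < b -> x < n -> P x -> P (act k x)) ->
  forall g, g \in G a b -> stabilizes P g.
Proof.
move=> kP; apply: interval_ind => [x xP|g h|k kr kab]; first by rewrite perm1.
  exact: stabilizesM.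
by apply: stabilizes_rho => // x; apply: kP.
Qed.

(* The elements h * s, with h in K stabilizing P and s supported on P, form a group. *)
Lemma interval_split a b (K : {group {perm 'I_n}}) P :
    (forall k, k < r -> a <= k < b -> supported P (rho k) \/ (rho k \in K /\ stabilizes P (rho k))) ->
  forall g, g \in G a b -> exists2 h, h \in K & supported P (h^-1 * g).
Proof.
move=> split_rho g gG.
suffices [h [s [hK hP sP ->]]] : exists h s, [/\ h \in K, stabilizes P h, supported P s & g = h * s].
  by exists h; rewrite ?mulKg.
move: g gG; apply: interval_ind => [|g1 g2 [h1 [s1 [K1 P1 S1 ->]]] [h2 [s2 [K2 P2 S2 ->]]]|k kr kab].
- by exists 1, 1; split; rewrite ?mulg1 ?group1 // => x; rewrite perm1.
- exists (h1 * h2), (s1 ^ h2 * s2); split; first exact: groupM.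
  + exact: stabilizesM.
  + by apply: supportedM => //; apply: supportedJ.
  + by rewrite -mulgA -mulgA [s1 * _]mulgA [h2 * (_ * _)]mulgA -conjgC.
- have [kP|[kK kP]] := split_rho k kr kab.
    by exists 1, (rho k); split; rewrite ?mul1g // => x; rewrite perm1.
  by exists (rho k), 1; split; rewrite ?mulg1 // => x; rewrite perm1.
Qed.

Lemma intervalS a b a' b' : a' <= a -> b <= b' -> G a b \subset G a' b'.
Proof. by move=> aa bb; apply/subgenS/subsetP=> i; rewrite !inE; lia. Qed.

(** * Intersections with a <= 2 *)

Definition lower b : pred nat := fun x =>
  (x <= M + b) || (r - 2 <= b) && (M + r + 2 <= x <= M + r - 1 + b)%N.

(** The generators 0, 1, 2 live on [lower b] and the others preserve it, so the others can be
    factored out. *)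
Lemma split_lower b : 3 <= b -> b < r -> forall g, g \in G 0 b ->
  exists2 h, h \in G 3 b & supported (lower b) (h^-1 * g).
Proof.
move=> b3 br; apply: (interval_split (K := interval_group_group r rho 3 b)) => k kr kb.
have [k3|k3] := ltnP k 3; [left|right].
{ apply: supported_rho => // x xn; rewrite /lower negb_or => /andP[xb _].
  have [k0|[k1|k2]] : k = 0 \/ k = 1%N \/ k = 2 by lia.
  all: subst k; repeat eval_act; lia. }
split; first by apply: mem_interval; lia.
apply: stabilizes_rho => // x xn; rewrite /lower => xb.
by repeat eval_act; lia.
Qed.

(** The roles are reversed here: the generators from 3 on fix every point below M + a, and those
    below 3 are factored out. *)
Lemma split_upper a : 0 < a <= 2 -> forall g, g \in G a r ->
  exists2 h, h \in G a 3 & supported (fun x => M + a <= x) (h^-1 * g).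
Proof.
move=> a12; apply: (interval_split (K := interval_group_group r rho a 3)) => k kr kb.
have [k3|k3] := leqP 3 k.
  by left; apply: supported_rho => // x xn; rewrite -ltnNge => xa; apply: act_fix; lia.
right; split; first by apply: mem_interval; lia.
apply: stabilizes_rho => // x xn xa.
have [k1|k2] : k = 1%N \/ k = 2 by lia.
all: subst k; repeat eval_act; lia.
Qed.

(** Two points carry no 3-cycle, so they form a full set for the trivial group and [full3_even]
    applies to it. *)
Lemma even_supported2 x y g : supported (fun z => (z == x) || (z == y)) g -> odd_perm g = false ->
  g = 1.
Proof.
move=> gS g_even; apply/set1gP.
apply: (@full3_even _ (one_group _) [set z : 'I_n | (z == x :> nat) || (z == y :> nat)]);
  last by rewrite g_even.
  apply/full3P=> a b c; rewrite !inE -![_ == _ :> 'I_n]val_eqE /=.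
  by case/orP=> /eqP-> /orP[]/eqP-> /orP[]/eqP->; rewrite eqxx.
by apply/subsetP=> z; rewrite !inE; apply: contraR => /gS/eqP.
Qed.

Lemma upper_supported a b g : a <= 2 -> g \in G 3 b -> supported (fun x => M + a <= x) g.
Proof.
move=> a2; apply: supported_interval => k x kr kb xn; rewrite -ltnNge => xa.
by apply: act_fix; lia.
Qed.

(** Factor g = d h t with d in [G a 3] and h in [G 3 b]. Both lie in [G a b], and the even remainder
    t is supported on [region a b], where [full_interval] applies. For a = 2 and b = 3 only two
    points are left and t is trivial. *)
Lemma interval_cap_low a b : 0 < a <= 2 -> 3 <= b -> b < r ->
  G 0 b :&: G a r \subset G a b.
Proof.
move=> a12 b3 br; apply/subsetP=> g /setIP[g0 gr].
have [d dK dS] := split_upper a12 gr.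
have a3 : a <= 3 by lia.
have d0 : d \in G 0 b by apply: subsetP dK; apply: intervalS.
have dab : d \in G a b by apply: subsetP dK; apply: intervalS.
have s0 : d^-1 * g \in G 0 b by rewrite groupM ?groupV.
have [h hK hS] := split_lower b3 br s0.
have hab : h \in G a b by apply: subsetP hK; apply: intervalS.
have h0 : h \in G 0 b by apply: subsetP hK; apply: intervalS.
have hU : supported (fun x => M + a <= x) h := upper_supported (proj2 (andP a12)) hK.
have t0 : h^-1 * (d^-1 * g) \in G 0 b by rewrite groupM ?groupV.
rewrite -[g](mulKVg d) groupM // -[_ * g](mulKVg h) groupM //.
have even_t := odd_interval t0.
have tS := supportedI (supportedM (supportedV hU) dS) hS.
have [[ab|ab]|[a2 b_eq3]] : ((a <= 1 /\ 3 <= b) \/ (a = 2 /\ 4 <= b)) \/ (a = 2 /\ b = 3).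
- by clear - a12 b3; lia.
- apply: (full_interval (or_introl ab) (ltnW br)); last exact: even_t.
  move=> x xR; apply: tS; apply: contra xR; rewrite /lower /region (_ : (a == 0) = false).
    by clear - a12 b3 br; lia.
  by clear - a12; lia.
- apply: (full_interval (or_intror ab) (ltnW br)); last exact: even_t.
  move=> x xR; apply: tS; apply: contra xR; rewrite /lower /region (_ : (a == 0) = false).
    by clear - a12 b3 br; lia.
  by clear - a12; lia.
rewrite (even_supported2 (x := M + 2) (y := M + 3) _ even_t) ?group1 //.
by move=> x xR; apply: tS; apply: contra xR; rewrite /lower; clear - a2 b_eq3 r_ge; lia.
Qed.

Lemma fix_low a k : k < a <= 2 -> forall g, g \in G a r -> k + a <= 3 -> g (pt k) = pt k.
Proof.
move=> ka g gG ka3; apply: (supported_interval (P := fun x => x != k) _ gG).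
{ move=> j x jr ja xn /negPn/eqP->.
  have [k0|k1] : k = 0 \/ k = 1%N by lia.
  all: subst k; repeat eval_act; lia. }
by rewrite val_point ?eqxx //; lia.
Qed.

Lemma interval_cap_1 : G 0 1 :&: G 1 r \subset G 1 1.
Proof.
apply/subsetP=> g /setIP[g0 g1].
have [->|g_rho] : g = 1 \/ g = rho 0; [|exact: group1|].
{ move: g g0 {g1}; apply: interval_ind => [|g h [->|->] [->|->]|[|k] kr k1 //]; rewrite ?mul1g ?mulg1.
  all: by [left | right | left; apply: rho_invol; lia]. }
have act00 : act 0 0 = 1%N by repeat eval_act; lia.
have r0 : 0 < r by lia.
have n1 : 1 < n by lia.
by have /eqP := fix_low (isT : 0 < 1 <= 2) g1 isT; rewrite g_rho rho_pt // act00 point_eq.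
Qed.

(** The alternatives are the rotations and the reflections of a dihedral group; [rho 1] normalizes
    the rotations. *)
Lemma interval_0_2_dihedral g : g \in G 0 2 ->
  g \in <[rho 0 * rho 1]> \/ g * rho 1 \in <[rho 0 * rho 1]>.
Proof.
have r0 : rho 0 * rho 0 = 1 by apply: rho_invol; lia.
have r1 : rho 1 * rho 1 = 1 by apply: rho_invol; lia.
have r1K x : rho 1 * (rho 1 * x) = x by rewrite mulgA r1 mul1g.
have r1V : (rho 1)^-1 = rho 1 by apply/eqP; rewrite eq_invg_mul r1.
have r0V : (rho 0)^-1 = rho 0 by apply/eqP; rewrite eq_invg_mul r0.
have norm1 h : h \in <[rho 0 * rho 1]> -> h ^ rho 1 \in <[rho 0 * rho 1]>.
  move=> hC; rewrite -[<[_]>]cycleV invMg r0V r1V.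
  rewrite (_ : rho 1 * rho 0 = (rho 0 * rho 1) ^ rho 1); last first.
    by rewrite conjgE r1V -!mulgA r1 mulg1.
  by rewrite cycleJ memJ_conjg.
move: g; apply: interval_ind => [|g h|k kr k2]; first by left; apply: group1.
  case=> gC [hC|hC]; [left|right|right|left].
  - exact: groupM.
  - by rewrite -mulgA groupM.
  - have -> : g * h * rho 1 = (g * rho 1) * h ^ rho 1; last by rewrite groupM ?norm1.
    by rewrite conjgE r1V -(mulgA g (rho 1)) r1K mulgA.
  - have -> : g * h = (g * rho 1) * (h * rho 1) ^ rho 1; last by rewrite groupM ?norm1.
    by rewrite conjgE r1V -(mulgA g (rho 1)) r1K -(mulgA h) r1 mulg1.
by case: k kr k2 => [|[|//]] _ _; right; [apply: cycle_id | rewrite r1 group1].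
Qed.

Lemma path_cycle_fix0 g : g \in <[rho 0 * rho 1]> -> g (pt 0) = pt 0 -> g = 1.
Proof.
case/cycleP=> i -> /(congr1 val) /=.
have r0 : 0 < r by lia.
have r1 : 1 < r by lia.
rewrite pair_powE // val_point // => /path_iter0.
by rewrite -order_01 order_dvdn => /eqP.
Qed.

(** g fixes p_1, and so does rho_1. A rotation fixing p_1 is trivial, so g is 1 or rho_1; for a = 2
    the latter is excluded because rho_1 moves p_2, which the upper group fixes. *)
Lemma interval_cap_2 a : 0 < a <= 2 -> G 0 2 :&: G a r \subset G a 2.
Proof.
move=> a12; apply/subsetP=> g /setIP[g0 ga].
have g_fix0 : g (pt 0) = pt 0 by apply: (fix_low _ ga); lia.
have r1_fix0 : rho 1 (pt 0) = pt 0.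
  by rewrite rho_pt //; lia.
have [gC|gC] := interval_0_2_dihedral g0.
  by rewrite (path_cycle_fix0 gC) ?group1.
have : g * rho 1 = 1 by apply: path_cycle_fix0 => //; rewrite permM g_fix0.
move/(canRL (mulgK _)); rewrite mul1g => g_def.
have [a1|a2] : a = 1%N \/ a = 2 by lia.
  by rewrite g_def groupV a1; apply: mem_interval; lia.
have act11 : act 1 1 = 2 by repeat eval_act; lia.
have r1 : 1 < r by lia.
have n2 : 2 < n by lia.
have : g (pt 1) = pt 1 by apply: (fix_low _ ga); lia.
move/(congr1 (rho 1)); rewrite g_def permKV rho_pt //; last exact: ltnW.
by move/eqP; rewrite act11 point_eq //; apply: ltnW.
Qed.

Lemma interval_swap_yz a b g x : 3 <= a -> g \in G a b -> x < n ->
  g (pt (swap_yz x)) = pt (swap_yz (g (pt x))).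
Proof.
move=> a3; move: g x.
suffices gP g : g \in G a b -> forall x : 'I_n, g (pt (swap_yz x)) = pt (swap_yz (g x)).
  by move=> g x /gP gx xn; rewrite -gx val_point.
move: g; apply: interval_ind => [x|g h gP hP x|k kr kab x]; first by rewrite !perm1.
  by rewrite !permM gP hP.
by rewrite rho_pt ?swap_yz_lt // act_swap_yz ?rhoE //; lia.
Qed.

(** * Permutations of the pairs y_j, z_j *)

(* The points y_j and z_j with a <= j <= m. *)
Definition pairs (a m : nat) : pred nat := fun x =>
  (M + a <= x <= M + m) || (M + r - 1 + a <= x <= M + r - 1 + m)%N.

Lemma interval_pairs a b g : 3 <= a -> b <= r -> g \in G a b -> supported (pairs a r.+1) g.
Proof.
move=> a3 br; apply: supported_interval => k x kr kab xn.
by rewrite /pairs => xP; apply: act_fix; lia.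
Qed.

(** g commutes with [swap_yz], so fixing one point of the pair m + 1 fixes both. *)
Lemma supported_shrink a b m x g : 3 <= a -> a <= m -> m <= r -> g \in G a b ->
    x = (M + m.+1)%N \/ x = (M + r - 1 + m.+1)%N ->
  supported (pairs a m.+1) g -> g (pt x) = pt x -> supported (pairs a m) g.
Proof.
move=> a3 am mr gG xm gS gx z zP.
have xn : x < n by clear - xm mr n_def r_ge; lia.
have gx' : g (pt (swap_yz x)) = pt (swap_yz x).
  by rewrite (interval_swap_yz a3 gG xn) gx val_point.
have [zS|/gS//] := boolP (pairs a m.+1 z).
suffices [->|->] : z = pt x \/ z = pt (swap_yz x) by [].
suffices : z = x :> nat \/ z = swap_yz x :> nat.
  by case=> [zx|zx]; [left|right]; apply: val_inj; rewrite /= val_point ?swap_yz_lt.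
clear - zP zS xm a3 am mr r_ge; rewrite /pairs /swap_yz in zP zS *.
by move: (nat_of_ord z) zP zS => {}z zP zS; case: xm => ->; repeat case_if; lia.
Qed.

Definition pair_tperm (u : nat -> nat) (i j : nat) : {perm 'I_n} :=
  tperm (pt (u i)) (pt (u j)) * tperm (pt (swap_yz (u i))) (pt (swap_yz (u j))).

(** A single exchange of y_i and z_i is odd, so exchanges have to come in twos. *)
Definition flip2 (i j : nat) : {perm 'I_n} :=
  tperm (pt (M + i)) (pt (M + r - 1 + i)) * tperm (pt (M + j)) (pt (M + r - 1 + j)).

(* One point u j chosen in each pair {y_j, z_j}. *)
Definition sheet (u : nat -> nat) := forall j, 3 <= j <= r.+1 ->
  u j = (M + j)%N \/ u j = (M + r - 1 + j)%N.

Lemma sheet_cases u j : sheet u -> 3 <= j <= r.+1 ->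
  (u j = M + j /\ swap_yz (u j) = M + r - 1 + j)%N \/
  (u j = M + r - 1 + j /\ swap_yz (u j) = M + j)%N.
Proof.
by move=> uS jr; case: (uS j jr) => ->; [left|right]; split=> //; rewrite /swap_yz; repeat case_if; lia.
Qed.

Lemma pair_tpermE u i j (x : 'I_n) : sheet u -> 3 <= i <= r.+1 -> 3 <= j <= r.+1 ->
  pair_tperm u i j x = swapn (swap_yz (u i)) (swap_yz (u j)) (swapn (u i) (u j) x) :> nat.
Proof.
move=> uS ir jr; rewrite permM.
have [iP jP] := (sheet_cases uS ir, sheet_cases uS jr).
by rewrite !tperm_pointE //; clear - iP jP ir jr n_def M_ge r_ge; lia.
Qed.

Lemma sheet_lt u j : sheet u -> 3 <= j <= r.+1 -> u j < n.
Proof. by move=> uS jr; have := uS j jr; clear - jr n_def r_ge; lia. Qed.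

Lemma pair_tperm_L u i j : sheet u -> 3 <= i <= r.+1 -> 3 <= j <= r.+1 -> i <> j ->
  pair_tperm u i j (pt (u i)) = pt (u j).
Proof.
move=> uS ir jr ij; apply: val_inj; rewrite /= pair_tpermE // !val_point ?sheet_lt //.
have [iP jP] := (sheet_cases uS ir, sheet_cases uS jr).
by rewrite /swapn; clear - iP jP ir jr ij M_ge r_ge; repeat case_if; lia.
Qed.

Lemma pair_tperm_D u i j k : sheet u -> 3 <= i <= r.+1 -> 3 <= j <= r.+1 -> 3 <= k <= r.+1 ->
  k <> i -> k <> j -> pair_tperm u i j (pt (u k)) = pt (u k).
Proof.
move=> uS ir jr kr ki kj; apply: val_inj; rewrite /= pair_tpermE // !val_point ?sheet_lt //.
have [iP [jP kP]] := (sheet_cases uS ir, (sheet_cases uS jr, uS k kr)).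
by rewrite /swapn; clear - iP jP kP ir jr kr ki kj M_ge r_ge; repeat case_if; lia.
Qed.

(** A sheet and its mirror image merely interchange the two factors. Facts proved for the first
    factor thus transfer to the second. *)
Lemma pair_tperm_swap u i j : sheet u -> 3 <= i <= r.+1 -> 3 <= j <= r.+1 ->
  pair_tperm (swap_yz \o u) i j = pair_tperm u i j.
Proof.
move=> uS ir jr; have uS' : sheet (swap_yz \o u).
  by move=> k kr /=; case: (sheet_cases uS kr) => -[_ ->]; [right|left].
apply/permP=> x; apply: val_inj; rewrite /= !pair_tpermE //=.
have [iP jP] := (sheet_cases uS ir, sheet_cases uS jr).
have [iP' jP'] := (sheet_cases uS' ir, sheet_cases uS' jr).
rewrite /= in iP' jP'; have [<- <-] : u i = swap_yz (swap_yz (u i)) /\ u j = swap_yz (swap_yz (u j)).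
  by clear - iP jP iP' jP' r_ge ir jr; lia.
move: (nat_of_ord x) => {}x; rewrite /swapn.
by clear - iP jP ir jr M_ge r_ge; repeat case_if; lia.
Qed.

Lemma pair_tperm_pairs u i j a m : sheet u -> 3 <= a -> m <= r.+1 -> a <= i <= m -> a <= j <= m ->
  supported (pairs a m) (pair_tperm u i j).
Proof.
move=> uS a3 mr im jm x xP; apply: val_inj.
have [ir jr] : 3 <= i <= r.+1 /\ 3 <= j <= r.+1 by clear - a3 mr im jm; lia.
rewrite /= pair_tpermE //.
have [iP jP] := (sheet_cases uS ir, sheet_cases uS jr).
move: (nat_of_ord x) xP => {}x; rewrite /pairs /swapn.
by clear - iP jP ir jr im jm a3 mr M_ge r_ge => xP; repeat case_if; lia.
Qed.

Lemma pair_tperm_sheet u i j k m a : sheet u -> 3 <= a -> m <= r.+1 -> a <= i <= m -> a <= j <= m ->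
  i <> j -> a <= k <= m -> exists2 l, a <= l <= m & pair_tperm u i j (pt (u k)) = pt (u l).
Proof.
move=> uS a3 mr im jm ij km.
have [[ir jr] kr] : (3 <= i <= r.+1 /\ 3 <= j <= r.+1) /\ 3 <= k <= r.+1.
  by clear - a3 mr im jm km; lia.
have [->|ki] := eqVneq k i; first by exists j; [|apply: pair_tperm_L].
have [->|kj] := eqVneq k j.
  exists i => //; rewrite /pair_tperm tpermC [tperm (pt (swap_yz _)) _]tpermC.
  by apply: (pair_tperm_L uS jr ir) => /esym.
by exists k => //; apply: pair_tperm_D => //; apply/eqP.
Qed.

(** As in the symmetric group, conjugating the transposition of i and j by that of j and j + 1 moves
    j up. *)
Lemma pair_tperm_gen u a m (H : {group {perm 'I_n}}) : sheet u -> 3 <= a -> m <= r.+1 ->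
    (forall i, a <= i < m -> pair_tperm u i i.+1 \in H) ->
  forall i j, a <= i < j -> j <= m -> pair_tperm u i j \in H.
Proof.
move=> uS a3 mr uH i; elim=> [|j IH] ij jm; first by lia.
have [->|ij'] := eqVneq i j; first by apply: uH; lia.
have IHij : pair_tperm u i j \in H by apply: IH; lia.
have uHj : pair_tperm u j j.+1 \in H by apply: uH; lia.
have [ir [jr j1r]] : 3 <= i <= r.+1 /\ 3 <= j <= r.+1 /\ 3 <= j.+1 <= r.+1.
  by clear - a3 mr ij jm ij'; lia.
have uS' : sheet (swap_yz \o u).
  by move=> k kr /=; case: (sheet_cases uS kr) => -[_ ->]; [right|left].
have := groupJ IHij uHj.
rewrite {1}/pair_tperm conjMg !tpermJ.
have [jj1 [ij1 ij2]] : j <> j.+1 /\ i <> j /\ i <> j.+1 by clear - ij ij'; lia.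
rewrite pair_tperm_L // pair_tperm_D //.
(* The second factor is computed as the first factor for the mirror sheet. *)
rewrite -(pair_tperm_swap uS jr j1r).
by rewrite (pair_tperm_L uS' jr j1r) // (pair_tperm_D uS' jr j1r ir).
Qed.

Lemma supported_one_pair a b x g : 3 <= a <= r.+1 -> g \in G a b ->
    x = (M + a)%N \/ x = (M + r - 1 + a)%N ->
  supported (pairs a a) g -> g (pt x) = pt x -> g = 1.
Proof.
move=> ar gG xa gS gx; have a3 : 3 <= a by case/andP: ar.
have xn : x < n by clear - xa ar n_def r_ge; lia.
have gx' : g (pt (swap_yz x)) = pt (swap_yz x).
  by rewrite (interval_swap_yz a3 gG xn) gx val_point.
apply/permP=> z; rewrite perm1; have [zS|/gS//] := boolP (pairs a a z).
suffices [->|->] : z = pt x \/ z = pt (swap_yz x) by [].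
suffices : z = x :> nat \/ z = swap_yz x :> nat.
  have sn := swap_yz_lt xn.
  by case=> [zx|zx]; [left|right]; apply: val_inj; rewrite /= val_point.
clear - zS xa ar r_ge; rewrite /pairs /swap_yz in zS *.
by move: (nat_of_ord z) zS => {}z zS; case: xa => ->; repeat case_if; lia.
Qed.

(** Commuting with [swap_yz] makes g determined by its action on the sheet. Composing with one pair
    transposition brings the image of the top sheet point back; then the support shrinks and
    induction on m applies. *)
Lemma sheet_subgroup u a m (H : {group {perm 'I_n}}) g : sheet u -> 3 <= a -> a <= m -> m <= r.+1 ->
    H \subset G a r -> (forall i j, a <= i < j -> j <= m -> pair_tperm u i j \in H) ->
    g \in G a r -> supported (pairs a m) g ->
    (forall j, a <= j <= m -> exists2 i, a <= i <= m & g (pt (u j)) = pt (u i)) ->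
  g \in H.
Proof.
move=> uS a3 am mr /subsetP HG uH; elim: m am mr uH g => [|m IH] am mr uH g gG gS gu.
  by exfalso; clear - am a3; lia.
have [am'|ltam] := eqVneq a m.+1.
  have aa : a <= a <= m.+1 by rewrite leqnn am.
  have [i im gi] := gu a aa.
  have ia : i = a by clear - im am'; lia.
  have ar : 3 <= a <= r.+1 by clear - a3 am mr; lia.
  rewrite (supported_one_pair ar gG (uS a ar) _ _) //; first by rewrite {2}am'.
  by rewrite gi ia.
have [am1 mr1] : a <= m /\ m <= r by clear - am mr ltam; lia.
have m1r : 3 <= m.+1 <= r.+1 by clear - a3 am mr; lia.
have top : a <= m.+1 <= m.+1 by rewrite am leqnn.
suffices [h hH [[hS hu] hg]] : exists2 h, h \in H & [/\ supported (pairs a m.+1) h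
    /\ forall k, a <= k <= m.+1 -> exists2 l, a <= l <= m.+1 & h (pt (u k)) = pt (u l)
    & h (g (pt (u m.+1))) = pt (u m.+1)].
  rewrite -(groupMr _ hH); have ghG : g * h \in G a r := groupM gG (HG h hH).
  have gh_top : (g * h) (pt (u m.+1)) = pt (u m.+1) by rewrite permM.
  apply: IH => //; first exact: leqW.
    by move=> i j ij jm; apply: uH => //; apply: leqW.
    exact: supported_shrink a3 am1 mr1 ghG (uS _ m1r) (supportedM gS hS) gh_top.
  move=> j jm; have jm1 : a <= j <= m.+1 by clear - jm; lia.
  have [i im gi] := gu j jm1; have [l lm hl] := hu i im.
  exists l; last by rewrite permM gi.
  suffices lm1 : l != m.+1 by clear - lm lm1; lia.
  apply/eqP=> l_eq; have : (g * h) (pt (u j)) = (g * h) (pt (u m.+1)).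
    by rewrite gh_top permM gi hl l_eq.
  have jr : 3 <= j <= r.+1 by clear - jm a3 mr1; lia.
  move/perm_inj/(congr1 val); rewrite /= !val_point ?sheet_lt //.
  by have := uS j jr; have := uS _ m1r; clear - jm mr1 a3 r_ge; lia.
have [i im gi] := gu m.+1 top.
have [i_m|i_m] := eqVneq i m.+1.
  exists 1; rewrite ?group1 //; split; last by rewrite perm1 gi i_m.
  by split=> [x _|k km]; [rewrite perm1 | exists k; rewrite ?perm1].
have ir : 3 <= i <= r.+1 by clear - im a3 mr; lia.
have ij : a <= i < m.+1 by clear - im i_m; lia.
exists (pair_tperm u i m.+1); first exact: uH.
split; last by rewrite gi pair_tperm_L //; apply/eqP.
split; first exact: pair_tperm_pairs.
by move=> k km; apply: pair_tperm_sheet => //; apply/eqP.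
Qed.

Definition y_sheet (j : nat) : nat := M + j.

Lemma y_sheetP : sheet y_sheet. Proof. by move=> j _; left. Qed.

Lemma y_sheet_swap j : 3 <= j <= r.+1 -> swap_yz (y_sheet j) = (M + r - 1 + j)%N.
Proof. by move=> jr; rewrite /swap_yz /y_sheet; repeat case_if; lia. Qed.

Lemma flip2C i j : 3 <= i <= r.+1 -> 3 <= j <= r.+1 -> i <> j -> flip2 i j = flip2 j i.
Proof.
move=> ir jr ij; apply/permP=> x; apply: val_inj; rewrite /= /flip2 !permM !tperm_pointE //=;
  try (clear - ir jr n_def r_ge; lia).
move: (nat_of_ord x) => {}x; rewrite /swapn.
by clear - ir jr ij r_ge; repeat case_if; lia.
Qed.

Lemma flip2_pt i j k : 3 <= i <= r.+1 -> 3 <= j <= r.+1 -> i <> j -> (k = i \/ k = j) ->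
  flip2 i j (pt (M + r - 1 + k)) = pt (M + k).
Proof.
move=> ir jr ij kij; apply: val_inj; rewrite /= /flip2 !permM !tperm_pointE //=;
  try (clear - kij ir jr n_def r_ge; lia).
rewrite !val_point; try (clear - kij ir jr n_def r_ge; lia).
by rewrite /swapn; clear - ir jr ij r_ge kij; repeat case_if; lia.
Qed.

Lemma flip2_pairs i j a m : 3 <= a -> m <= r.+1 -> a <= i <= m -> a <= j <= m ->
  supported (pairs a m) (flip2 i j).
Proof.
move=> a3 mr im jm x; move=> xP; apply: val_inj; rewrite /= /flip2 !permM !tperm_pointE //=;
  try (clear - im jm a3 mr n_def r_ge; lia).
move: (nat_of_ord x) xP => {}x; rewrite /pairs /swapn.
by clear - im jm a3 mr r_ge => xP; repeat case_if; lia.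
Qed.

(** Conjugation by the transposition of the pairs j and k turns [flip2 i j] into [flip2 i k], and
    such moves connect all two-element sets of pairs. *)
Lemma flip2_gen a m (H : {group {perm 'I_n}}) p q : 3 <= a -> m <= r.+1 ->
    (forall i j, a <= i < j -> j <= m -> pair_tperm y_sheet i j \in H) ->
    a <= p <= m -> a <= q <= m -> p <> q -> flip2 p q \in H ->
  forall i j, a <= i <= m -> a <= j <= m -> i <> j -> flip2 i j \in H.
Proof.
move=> a3 mr uH pm qm pq pqH.
have in_r i : a <= i <= m -> 3 <= i <= r.+1 by clear - a3 mr; lia.
have uH' i j : a <= i <= m -> a <= j <= m -> i <> j -> pair_tperm y_sheet i j \in H.
  move=> im jm ij; have [ltij|leji] := ltnP i j; first by apply: uH; clear - im jm ltij; lia.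
  rewrite /pair_tperm tpermC [tperm (pt (swap_yz _)) _]tpermC.
  by apply: uH; clear - im jm leji ij; lia.
have move2 i j k : a <= i <= m -> a <= j <= m -> a <= k <= m -> i <> j -> i <> k -> j <> k ->
    flip2 i j \in H -> flip2 i k \in H.
  move=> im jm km ij ik jk ijH; have := groupJ ijH (uH' j k jm km jk).
  have swap_sheet : sheet (swap_yz \o y_sheet) by move=> l lr /=; right; apply: y_sheet_swap.
  have [ir [jr kr]] := (in_r i im, (in_r j jm, in_r k km)).
  rewrite /flip2 conjMg !tpermJ.
  rewrite -[(M + i)%N]/(y_sheet i) -[(M + j)%N]/(y_sheet j) -[(M + k)%N]/(y_sheet k).
  rewrite (pair_tperm_L y_sheetP) // (pair_tperm_D y_sheetP jr kr ir) //.
  rewrite -!y_sheet_swap // -(pair_tperm_swap y_sheetP) //.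
  by rewrite (pair_tperm_L swap_sheet) // (pair_tperm_D swap_sheet jr kr ir).
have sym i j : a <= i <= m -> a <= j <= m -> i <> j -> flip2 i j \in H -> flip2 j i \in H.
  by move=> im jm ij; rewrite flip2C ?in_r //; apply/nesym.
have from i k : a <= i <= m -> a <= k <= m -> i <> k ->
    (exists2 j, a <= j <= m & i <> j /\ flip2 i j \in H) -> flip2 i k \in H.
  move=> im km ik [j jm [ij ijH]]; have [<-//|/eqP jk] := eqVneq j k.
  exact: (move2 i j k).
move=> i j im jm ij; apply: (from i j) => //.
have [->|/eqP ip] := eqVneq i p; first by exists q.
exists p => //; split=> //; apply: (sym p i) => //; first exact/nesym.
by apply: from => //; [apply/nesym | exists q].
Qed.

(** A pair transposition brings the top pair home and [flip2 a m.+1] corrects its orientation at the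
    cost of the pair a. When only the pair a is left, parity forces the identity. *)
Lemma even_pairs_subgroup a m (H : {group {perm 'I_n}}) g : 3 <= a -> a <= m -> m <= r.+1 ->
    H \subset G a r -> (forall i j, a <= i < j -> j <= m -> pair_tperm y_sheet i j \in H) ->
    (forall i j, a <= i <= m -> a <= j <= m -> i <> j -> flip2 i j \in H) ->
    g \in G a r -> supported (pairs a m) g -> g \in H.
Proof.
move=> a3 am mr /subsetP HG uH fH; elim: m am mr uH fH g => [|m IH] am mr uH fH g gG gS.
  by exfalso; clear - am a3; lia.
have [am'|ltam] := eqVneq a m.+1.
  have g_even := odd_interval gG.
  rewrite (even_supported2 (x := M + a) (y := M + r - 1 + a) _ g_even) ?group1 //.
  by move=> x xP; apply: gS; apply: contra xP; rewrite -am' /pairs; clear - a3; lia.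
have [am1 mr1] : a <= m /\ m <= r by clear - am mr ltam; lia.
have m1r : 3 <= m.+1 <= r.+1 by clear - a3 am mr; lia.
have top : a <= m.+1 <= m.+1 by rewrite am leqnn.
have bot : a <= a <= m.+1 by rewrite am leqnn.
have topn : M + m.+1 < n by clear - mr1 n_def r_ge; lia.
have atop : a <> m.+1 by apply/eqP.
suffices [h hH [hS hg]] : exists2 h, h \in H & supported (pairs a m.+1) h
    /\ h (g (pt (M + m.+1))) = pt (M + m.+1).
  rewrite -(groupMr _ hH); have ghG : g * h \in G a r := groupM gG (HG h hH).
  apply: IH => //; first exact: leqW.
  - by move=> i j ij jm; apply: uH => //; apply: leqW.
  - by move=> i j im jm; apply: fH; [clear - im | clear - jm]; lia.
  apply: (supported_shrink a3 am1 mr1 ghG (or_introl erefl) (supportedM gS hS)).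
  by rewrite permM.
have flip_top : supported (pairs a m.+1) (flip2 a m.+1) by apply: flip2_pairs.
have ar : 3 <= a <= r.+1 by clear - a3 am mr; lia.
have xP : pairs a m.+1 (g (pt (M + m.+1))).
  apply: contraT => gx; have gg := gS _ gx; have := perm_inj gg => gtop.
  move: gx; rewrite gtop val_point // /pairs; clear - am; lia.
have [i im gi] : exists2 i, a <= i <= m.+1 & g (pt (M + m.+1)) = pt (M + i) \/
    g (pt (M + m.+1)) = pt (M + r - 1 + i).
  move: xP; set x := g _; rewrite /pairs => /orP[]xP.
    exists (x - M)%N; first by clear - xP a3; lia.
    by left; rewrite -[LHS](point_val n_gt0); congr pt; clear - xP a3; lia.
  exists (x - (M + r - 1))%N; first by clear - xP a3; lia.
  by right; rewrite -[LHS](point_val n_gt0); congr pt; clear - xP a3; lia.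
have ir : 3 <= i <= r.+1 by clear - im a3 mr; lia.
have [i_m|/eqP i_m] := eqVneq i m.+1.
  case: gi => ->; rewrite i_m.
    by exists 1; rewrite ?group1 //; split=> [x _|]; rewrite perm1.
  exists (flip2 a m.+1); first exact: fH.
  by split=> //; apply: flip2_pt => //; right.
have ij : a <= i < m.+1 by clear - im i_m; lia.
have tH : pair_tperm y_sheet i m.+1 \in H by apply: uH.
have tS : supported (pairs a m.+1) (pair_tperm y_sheet i m.+1).
  by apply: pair_tperm_pairs => //; exact: y_sheetP.
case: gi => ->.
  exists (pair_tperm y_sheet i m.+1) => //; split=> //.
  exact: (pair_tperm_L y_sheetP).
exists (pair_tperm y_sheet i m.+1 * flip2 a m.+1); first by rewrite groupM ?fH.
split; first exact: supportedM.
have swap_sheet : sheet (swap_yz \o y_sheet) by move=> l lr /=; right; apply: y_sheet_swap.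
rewrite permM -y_sheet_swap // -(pair_tperm_swap y_sheetP) //.
rewrite (pair_tperm_L swap_sheet) //= y_sheet_swap //.
by apply: flip2_pt => //; right.
Qed.

Lemma pair_tpermJ a b u i j x y g : 3 <= a -> g \in G a b -> u i < n -> u j < n -> x < n -> y < n ->
    g (pt (u i)) = pt x -> g (pt (u j)) = pt y ->
  pair_tperm u i j ^ g = tperm (pt x) (pt y) * tperm (pt (swap_yz x)) (pt (swap_yz y)).
Proof.
move=> a3 gG iu ju xn yn gi gj; rewrite /pair_tperm conjMg !tpermJ gi gj.
by rewrite !(interval_swap_yz a3 gG) // gi gj !val_point.
Qed.

Lemma rho_pair_tperm k : 3 <= k -> k < r -> k <> r - 2 -> k <> r - 4 ->
  rho k = pair_tperm y_sheet k k.+1.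
Proof.
move=> k3 kr k_r2 k_r4; apply/permP=> x; apply: val_inj.
have [kr1 kr2] : 3 <= k <= r.+1 /\ 3 <= k.+1 <= r.+1 by clear - k3 kr; lia.
rewrite /= rhoE // (pair_tpermE _ y_sheetP kr1 kr2) !y_sheet_swap //.
by rewrite /y_sheet /swapn; repeat eval_act; repeat case_if; lia.
Qed.

(** Conjugation by rho_p rho_q may carry one sheet to another, hence separate [u] and [v]. It
    supplies the pair transpositions that are not themselves generators. *)
Lemma pair_tperm_rhoJ a b u v k l k' l' p q : 3 <= a -> b <= r -> a <= p < b -> a <= q < b ->
    u k < n -> u l < n ->
    act q (act p (u k)) = v k' -> act q (act p (u l)) = v l' ->
  pair_tperm u k l \in G a b -> pair_tperm v k' l' \in G a b.
Proof.
move=> a3 br pab qab uk ul vk vl uG.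
have pr : p < r by clear - pab br; lia.
have qr : q < r by clear - qab br; lia.
have gG : rho p * rho q \in G a b by rewrite groupM ?mem_interval.
have lt x : x < n -> act p x < n by apply: act_lt.
have img x : x < n -> (rho p * rho q) (pt x) = pt (act q (act p x)).
  by move=> xn; rewrite permM rho_pt // rho_pt // lt.
have lt2 x : x < n -> act q (act p x) < n.
  by move=> xn; apply: (act_lt qr); apply: lt.
have := groupJ uG gG; rewrite (@pair_tpermJ a b u k l (v k') (v l')) //.
- by rewrite -vk lt2.
- by rewrite -vl lt2.
- by rewrite img ?vk.
- by rewrite img ?vl.
Qed.

(** * Pair transpositions and flips inside the interval groups *)

Ltac y_eval := rewrite /y_sheet; repeat eval_act; lia.
Ltac y_lt := rewrite /y_sheet; clear - r_ge n_def; lia.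

Section Members.
Variables (a b : nat).
Hypotheses (a3 : 3 <= a) (br : b <= r).

Lemma rho_pair_mem k : a <= k < b -> k <> r - 2 -> k <> r - 4 ->
  pair_tperm y_sheet k k.+1 \in G a b.
Proof.
move=> kab k2 k4; rewrite -rho_pair_tperm //; try (clear - kab a3 br; lia).
by apply: mem_interval => //; clear - kab br; lia.
Qed.

(** rho_(r-4) also acts on the top pairs, so the bare transposition of the pairs r-4 and r-3 is
    obtained by shifting rho_(r-5) up by one pair. *)
Lemma pair_r4_mem : a <= r - 5 -> r - 3 <= b -> pair_tperm y_sheet (r - 4) (r - 3) \in G a b.
Proof.
move=> ar rb; apply: (@pair_tperm_rhoJ a b y_sheet y_sheet (r - 5) (r - 5).+1 _ _ (r - 4) (r - 5)) => //.
- by clear - ar rb r_ge; lia.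
- by clear - ar rb r_ge; lia.
- by y_lt.
- by y_lt.
- by y_eval.
- by y_eval.
- by apply: rho_pair_mem; clear - ar rb r_ge; lia.
Qed.

Lemma pair_r3_mem : a <= r - 3 -> r - 2 <= b -> pair_tperm y_sheet (r - 3) (r - 2) \in G a b.
Proof.
move=> ar rb; rewrite (_ : r - 2 = (r - 3).+1); last by clear - r_ge; lia.
by apply: rho_pair_mem; clear - ar rb r_ge; lia.
Qed.

(** rho_(r-2) also moves the pairs r and r+1; shifting rho_(r-3) up by one pair avoids them. *)
Lemma pair_r2_mem : a <= r - 3 -> r - 1 <= b -> pair_tperm y_sheet (r - 2) (r - 1) \in G a b.
Proof.
move=> ar rb; apply: (@pair_tperm_rhoJ a b y_sheet y_sheet (r - 3) (r - 2) _ _ (r - 2) (r - 3)) => //.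
- by clear - ar rb r_ge; lia.
- by clear - ar rb r_ge; lia.
- by y_lt.
- by y_lt.
- by y_eval.
- by y_eval.
- by apply: pair_r3_mem; clear - ar rb r_ge; lia.
Qed.

(** The transposition at r-4 is available for a <= r-5 and the one at r-2 for a <= r-3; the
    disjunction collects intervals where each of them is available or out of range. *)
Lemma y_pairs_mem : (b <= r - 3 /\ (a <= r - 5 \/ b <= r - 4)) \/ a <= r - 5 \/
    (a = r - 3 /\ b <= r - 1) -> b <= r - 1 ->
  forall i j, a <= i < j -> j <= b -> pair_tperm y_sheet i j \in G a b.
Proof.
move=> ab br1; have br' : b <= r.+1 by clear - br; lia.
apply: (pair_tperm_gen (H := interval_group_group r rho a b) y_sheetP a3 br').
move=> i iab; have [i4|/eqP i4] := eqVneq i (r - 4)%N.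
  rewrite i4 (_ : (r - 4).+1 = r - 3)%N; last by clear - r_ge; lia.
  by apply: pair_r4_mem; clear - ab iab i4 r_ge; lia.
have [i2|/eqP i2] := eqVneq i (r - 2)%N; last by apply: rho_pair_mem.
rewrite i2 (_ : (r - 2).+1 = r - 1)%N; last by clear - r_ge; lia.
by apply: pair_r2_mem; clear - ab iab i2 r_ge; lia.
Qed.

(* The sheet [z_(r-4), y_(r-3), y_(r-2), ..]: the group of [rho_(r-4), .., rho_(r-1)]
   preserves it or exchanges it with its mirror image. *)
Definition twisted_sheet (j : nat) : nat := if j == r - 4 then (M + r - 1 + j)%N else (M + j)%N.

Lemma twisted_sheetP : sheet twisted_sheet.
Proof. by move=> j _; rewrite /twisted_sheet; case: eqP => _; [right|left]. Qed.

(** Conjugating the transposition of the pairs r-3 and r-2 by rho_(r-4) rho_(r-3) sends y_(r-3) to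
    y_(r-4) but y_(r-2) to z_(r-3). This is what twists the sheet at r-4. *)
Lemma twisted_pair_mem : a <= r - 4 -> r - 2 <= b ->
  pair_tperm twisted_sheet (r - 4) (r - 3) \in G a b.
Proof.
move=> ar rb; rewrite -(pair_tperm_swap twisted_sheetP); try (clear - r_ge; lia).
apply: (@pair_tperm_rhoJ a b y_sheet (swap_yz \o twisted_sheet) (r - 3) (r - 2)
  _ _ (r - 4) (r - 3)) => //.
- by clear - ar rb r_ge; lia.
- by clear - ar rb r_ge; lia.
- by y_lt.
- by y_lt.
- rewrite /= /twisted_sheet eqxx [in RHS]/swap_yz; repeat case_if; try (clear - r_ge E; lia).
  by y_eval.
- rewrite /= /twisted_sheet ifF; last by clear - r_ge; lia.
  rewrite [in RHS]/swap_yz; repeat case_if; try (clear - r_ge E; lia).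
  by y_eval.
- by apply: pair_r3_mem; clear - ar rb r_ge; lia.
Qed.

Lemma twisted_pairs_mem : a = r - 4 -> r - 2 <= b -> b <= r - 1 ->
  forall i j, a <= i < j -> j <= b -> pair_tperm twisted_sheet i j \in G a b.
Proof.
move=> ar rb br1; have br' : b <= r.+1 by clear - br; lia.
apply: (pair_tperm_gen (H := interval_group_group r rho a b) twisted_sheetP a3 br').
move=> i iab; have [i4|/eqP i4] := eqVneq i (r - 4)%N.
  rewrite i4 (_ : (r - 4).+1 = r - 3)%N; last by clear - r_ge; lia.
  by apply: twisted_pair_mem; clear - ar rb; lia.
have -> : pair_tperm twisted_sheet i i.+1 = pair_tperm y_sheet i i.+1.
  rewrite /pair_tperm /twisted_sheet !ifF //; clear - iab ar i4; lia.
have [i2|/eqP i2] := eqVneq i (r - 2)%N; last by apply: rho_pair_mem.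
rewrite i2 (_ : (r - 2).+1 = r - 1)%N; last by clear - r_ge; lia.
by apply: pair_r2_mem; clear - ar rb iab i2 r_ge; lia.
Qed.

(** On the pairs r-4 and r-3 the two factors of [w] cancel, so [w] only exchanges the points of the
    four top pairs. Conjugating a pair transposition by [w] reverses just the pair r-2, and
    [tperm4_mul] turns the product with the original into a flip. *)
Lemma flip2_top_mem : a <= r - 5 -> r - 2 <= b -> flip2 (r - 3) (r - 2) \in G a b.
Proof.
move=> ar rb; set w := rho (r - 4) * pair_tperm y_sheet (r - 4) (r - 3).
have rho4 : rho (r - 4) \in G a b by apply: mem_interval; clear - ar rb r_ge; lia.
have wG : w \in G a b by rewrite groupM // pair_r4_mem //; clear - rb; lia.
have pG : pair_tperm y_sheet (r - 3) (r - 2) \in G a b by apply: pair_r3_mem; clear - ar rb; lia.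
have w3 : w (pt (y_sheet (r - 3))) = pt (M + r - 3).
  rewrite permM rho_pt; try y_lt.
  rewrite (_ : act (r - 4) (y_sheet (r - 3)) = y_sheet (r - 4)); last by y_eval.
  rewrite (pair_tperm_L y_sheetP); try (clear - r_ge; lia).
  by congr pt; rewrite /y_sheet; clear - r_ge; lia.
have w2 : w (pt (y_sheet (r - 2))) = pt (M + 2 * r - 3).
  rewrite permM rho_pt; try y_lt.
  have swapP : sheet (swap_yz \o y_sheet) by move=> l lr /=; right; apply: y_sheet_swap.
  rewrite (_ : act (r - 4) (y_sheet (r - 2)) = (swap_yz \o y_sheet) (r - 2)); last first.
    by rewrite /= y_sheet_swap; [y_eval | clear - r_ge; lia].
  rewrite -(pair_tperm_swap y_sheetP); try (clear - r_ge; lia).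
  rewrite (pair_tperm_D swapP); try (clear - r_ge; lia).
  by rewrite /= y_sheet_swap; [congr pt | ]; clear - r_ge; lia.
suffices -> : flip2 (r - 3) (r - 2) =
    pair_tperm y_sheet (r - 3) (r - 2) ^ w * pair_tperm y_sheet (r - 3) (r - 2).
  by rewrite groupM // groupJ.
rewrite (pair_tpermJ a3 wG _ _ _ _ w3 w2); try y_lt.
have e1 : swap_yz (M + r - 3) = (M + 2 * r - 4)%N.
  by rewrite /swap_yz; clear - r_ge; repeat case_if; lia.
have e2 : swap_yz (M + 2 * r - 3) = (M + r - 2)%N.
  by rewrite /swap_yz; clear - r_ge; repeat case_if; lia.
have e3 : swap_yz (M + r - 2) = (M + 2 * r - 3)%N.
  by rewrite /swap_yz; clear - r_ge; repeat case_if; lia.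
have y3 : y_sheet (r - 3) = (M + r - 3)%N by rewrite /y_sheet; clear - r_ge; lia.
have y2 : y_sheet (r - 2) = (M + r - 2)%N by rewrite /y_sheet; clear - r_ge; lia.
rewrite /pair_tperm y3 y2 e1 e2 e3 tperm4_mul; last first.
  by rewrite /= !inE !point_eq; clear - r_ge n_def; lia.
by rewrite /flip2; congr (tperm (pt _) (pt _) * tperm (pt _) (pt _)); clear - r_ge; lia.
Qed.

End Members.

(** * Intersections with a >= 3 *)

Lemma bounded_sheet_image a b g j : 3 <= a -> supported (pairs a b) g ->
    stabilizes (fun x => x <= M + b) g \/ stabilizes (fun x => x <= M + r + 1) g -> b <= r ->
    a <= j <= b -> exists2 i, a <= i <= b & g (pt (y_sheet j)) = pt (y_sheet i).
Proof.
move=> a3 gS gb br jab; set x := g _.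
have yn : y_sheet j < n by rewrite /y_sheet; clear - jab br n_def; lia.
have xb : x <= M + b \/ x <= M + r + 1.
  by case: gb => gb; [left|right]; apply: gb; rewrite val_point // /y_sheet; clear - jab br; lia.
have xP : pairs a b x.
  apply: contraT => gx; have /perm_inj xy := gS _ gx.
  by move: gx; rewrite xy val_point // /pairs /y_sheet; clear - jab a3; lia.
exists (x - M)%N; first by move: xP; rewrite /pairs; clear - xb a3 br; lia.
rewrite -[LHS](point_val n_gt0); congr pt; move: xP.
by rewrite /pairs /y_sheet; clear - xb a3 br; lia.
Qed.

(** Only rho_(r-4) and rho_(r-2) can act on pairs beyond b. The condition on a and b puts them into
    the interval group whenever they occur, so they can be factored out. *)
Lemma split_lower_pairs a b : 3 <= b -> b < r -> a <= r - 4 \/ b <= r - 4 ->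
  forall g, g \in G 0 b ->
  exists2 h, h \in G a b &
    supported (fun x => (x <= M + b) || (M + r + 2 <= x <= M + r - 1 + b)%N) (h^-1 * g).
Proof.
move=> b3 br abr; apply: (interval_split (K := interval_group_group r rho a b)) => k kr kb.
have [k_special|k_plain] : (k = r - 4 \/ k = r - 2) \/ (k <> r - 4 /\ k <> r - 2) by clear; lia.
  right; split; first by apply: mem_interval => //; clear - k_special kb br abr r_ge; lia.
  apply: stabilizes_rho => // x xn xb.
  by case: k_special => k_eq; rewrite k_eq in kb *; repeat eval_act; lia.
left; apply: supported_rho => // x xn xb.
have [k3|k3] := leqP 3 k.
  by apply: act_fix; clear - k3 kb xb xn k_plain br n_def r_ge; lia.
have [k0|[k1|k2]] : k = 0 \/ k = 1%N \/ k = 2 by clear - k3; lia.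
all: subst k; repeat eval_act; clear - xb b3; lia.
Qed.

Lemma lower_stable b : b <= r - 3 -> 3 <= b -> forall g, g \in G 0 b ->
  stabilizes (fun x => x <= M + b) g.
Proof.
move=> br b3; apply: stabilizes_interval => k x kr kb xn xb.
by repeat eval_act; lia.
Qed.

Lemma y_stable a b : r - 3 <= a -> forall g, g \in G a b -> stabilizes (fun x => x <= M + r + 1) g.
Proof.
move=> ar; apply: stabilizes_interval => k x kr kab xn xb.
by repeat eval_act; lia.
Qed.

Lemma yz_pair_stable b j : 3 <= b -> b <= r - 2 -> b < j <= r.+1 -> forall g, g \in G 0 b ->
  stabilizes (fun x => (x == M + j) || (x == M + r - 1 + j)%N) g.
Proof.
move=> b3 br jb; apply: stabilizes_interval => k x kr kb xn.
by case/orP=> /eqP->; repeat eval_act; lia.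
Qed.

Lemma top_stable g : g \in G 0 (r - 1) -> stabilizes (fun x =>
  (M + r <= x <= M + r + 1) || (M + 2 * r - 1 <= x))%N g.
Proof.
move: g; apply: stabilizes_interval => k x kr kb xn xP.
by repeat eval_act; lia.
Qed.

Definition twisted (x : nat) : bool := (x == M + 2 * r - 5) || (M + r - 3 <= x <= M + r + 1)%N.

(** rho_(r-4) exchanges the twisted sheet with its mirror image and the later generators preserve
    it; e counts the factors rho_(r-4) modulo 2. *)
Lemma twisted_stable g : g \in G (r - 4) r -> exists e, forall x : 'I_n,
  pairs (r - 4) r.+1 x -> pairs (r - 4) r.+1 (g x) /\ twisted (g x) = twisted x (+) e.
Proof.
move: g; apply: interval_ind => [|g h [e1 gP] [e2 hP]|k kr kab].
- by exists false => x xP; rewrite perm1 addbF.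
- exists (e1 (+) e2) => x xP; have [gx tg] := gP x xP; have [hx th] := hP _ gx.
  by rewrite permM th tg addbA.
exists (k == r - 4) => x xP; rewrite rhoE //.
have xn := ltn_ord x; move: (nat_of_ord x) xn xP => {}x xn xP; split.
  apply: contraLR xP => yP; suffices yx : act k x = x by rewrite -yx.
  have yn : act k x < n by apply: act_lt.
  rewrite -{2}(act_invol kr xn); apply/esym.
  apply: act_fix => //; move: (act k x) yn yP; rewrite /pairs;
    clear - kab kr r_ge n_def => y yn yP; lia.
have [k4|k4] := eqVneq k (r - 4)%N.
  rewrite k4 addbT; move: xP; rewrite /twisted /pairs; clear M_mod n_gt0 kr kab k4 => xP.
  by repeat eval_act; lia.
have [k1|[k2|k3]] : k = r - 1 \/ k = r - 2 \/ k = r - 3 by clear - kab kr k4; lia.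
all: subst k; rewrite addbF /twisted; clear M_mod n_gt0 xP kr kab k4; repeat eval_act; lia.
Qed.

(** Reversal of y_(r-2), .., y_(r+1): the central half turn of the dihedral group of order 8
    generated by rho_(r-2) and rho_(r-1) on these points. *)
Definition mirror (x : nat) : nat := (M + r - 2 + (M + r + 1) - x)%N.

Lemma block_stable g : g \in G (r - 2) r -> forall x : nat, M + r - 2 <= x <= M + r + 1 ->
  M + r - 2 <= g (pt x) <= M + r + 1 /\ g (pt (mirror x)) = mirror (g (pt x)) :> nat.
Proof.
have mn x : M + r - 2 <= x <= M + r + 1 -> x < n /\ M + r - 2 <= mirror x <= M + r + 1.
  by rewrite /mirror; clear - r_ge n_def; lia.
move: g; apply: interval_ind => [x xP|g h gP hP x xP|k kr kab x xP].
- by rewrite !perm1; have [xn /mn[mxn _]] := mn x xP; rewrite !val_point.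
- have [gx gm] := gP x xP; have [hx hm] := hP _ gx; rewrite !permM.
  rewrite point_val in hx hm; split=> //; rewrite -hm; congr (val (h _)).
  by apply: val_inj; rewrite /= gm val_point //; have [_ /mn[]] := mn _ gx.
have [xn mxP] := mn x xP; have [mxn _] := mn _ mxP.
rewrite !rhoE // !val_point // /mirror.
by repeat eval_act; lia.
Qed.

(** For j > b the lower group preserves the pair j and the upper group preserves the y side, so y_j
    is fixed. The support shrinks pair by pair down to j <= b, where the y sheet decides. *)
Lemma interval_cap_plain a b g : r - 3 <= a -> a <= b -> b <= r - 2 ->
  g \in G 0 b -> g \in G a r -> g \in G a b.
Proof.
move=> ar ab br g0 ga.
have a3 : 3 <= a by clear - ar r_ge; lia.
have b_r1 : b <= r.+1 by clear - br; lia.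
have b_r : b <= r by clear - br; lia.
have gy := y_stable ar ga.
have fixed j : b < j <= r.+1 -> g (pt (M + j)) = pt (M + j).
  move=> jb; have jn : M + j < n by clear - jb n_def r_ge; lia.
  apply: val_inj; rewrite /= val_point //.
  have y1 : g (pt (M + j)) <= M + r + 1 by apply: gy; rewrite val_point //; clear - jb; lia.
  have b3 : 3 <= b by clear - a3 ab; lia.
  have st := yz_pair_stable b3 br jb g0; have := st (pt (M + j)).
  rewrite val_point // eqxx => /(_ isT); clear - y1 jb ar ab r_ge; lia.
have gS i : i <= r.+1 - b -> supported (pairs a (r.+1 - i)) g.
  elim: i => [|i IH] ib; first by rewrite subn0; apply: (interval_pairs a3 _ ga).
  have e : r.+1 - i = (r.+1 - i.+1).+1 by clear - ib; lia.
  apply: (supported_shrink a3 _ _ ga (or_introl erefl)).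
  - by clear - ib ab b_r1; lia.
  - by clear; lia.
  - by rewrite -e; apply: IH; clear - ib; lia.
  - by apply: fixed; clear - ib b_r1; lia.
have gSb : supported (pairs a b) g.
  by have := gS (r.+1 - b) (leqnn _); rewrite subKn.
apply: (sheet_subgroup (H := interval_group_group r rho a b) y_sheetP a3 ab b_r1) => //.
- exact: intervalS.
- have [a_eq|a_neq] := eqVneq a (r - 2)%N.
    by move=> i j ij jb; exfalso; clear - a_eq br ij jb; lia.
  by apply: y_pairs_mem => //; clear - ar ab br a_neq r_ge; lia.
by move=> j jab; apply: bounded_sheet_image => //; right.
Qed.

(** Without rho_(r-1) the lower group keeps the pairs r and r+1 together; if g exchanges y_r and
    y_(r+1), composing with rho_(r-2) undoes it. *)
Lemma fix_top a g : r - 3 <= a -> a <= r - 2 -> g \in G 0 (r - 1) -> g \in G a r ->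
  exists2 h, h \in G a (r - 1) &
    (g * h) (pt (M + r + 1)) = pt (M + r + 1) /\ (g * h) (pt (M + r)) = pt (M + r).
Proof.
move=> ar ar2 g0 ga; have gy := y_stable ar ga; have gt := top_stable g0.
have top x : M + r <= x <= M + r + 1 -> M + r <= g (pt x) <= M + r + 1.
  move=> xP; have xn : x < n by clear - xP n_def r_ge; lia.
  have := gy (pt x); have := gt (pt x); rewrite !val_point //.
  by move: (g (pt x)) => y; clear - xP r_ge; lia.
have n1 : M + r + 1 < n by clear - n_def r_ge; lia.
have n0 : M + r < n by clear - n_def r_ge; lia.
have gx := top (M + r) _; have gx1 := top (M + r + 1)%N _.
have {}gx : M + r <= g (pt (M + r)) <= M + r + 1 by apply: gx; clear; lia.
have {}gx1 : M + r <= g (pt (M + r + 1)) <= M + r + 1 by apply: gx1; clear; lia.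
have neq : g (pt (M + r)) <> g (pt (M + r + 1)) :> nat.
  by move/val_inj/perm_inj/(congr1 val); rewrite /= !val_point //; clear; lia.
have to_pt (x : 'I_n) y : y < n -> x = y :> nat -> x = pt y.
  by move=> yn xy; apply: val_inj; rewrite /= val_point.
have [g1|g1] : (g (pt (M + r + 1)) = M + r + 1 :> nat \/ g (pt (M + r + 1)) = M + r :> nat)%N.
- by clear - gx1; lia.
- exists 1; rewrite ?group1 // mulg1; split; apply: to_pt => //.
  by clear - g1 gx neq; lia.
exists (rho (r - 2)); first by apply: mem_interval; clear - ar2 r_ge; lia.
have {}g1 := to_pt _ _ n0 g1.
have g0' : g (pt (M + r)) = pt (M + r + 1).
  by apply: to_pt => //; rewrite g1 val_point // in neq; clear - gx neq; lia.
have rr : r - 2 < r by clear - r_ge; lia.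
rewrite !permM g1 g0' !rho_pt //.
by split; congr pt; repeat eval_act; lia.
Qed.

(** For a = r-1 the upper group is {1, rho_(r-1)}, and rho_(r-1) takes y_r out of the last two
    pairs. Otherwise [fix_top] makes y_r and y_(r+1) fixed; then the y sheet settles a = r-3, and
    for a = r-2 the symmetry [mirror] fixes y_(r-1) and y_(r-2) as well. *)
Lemma interval_cap_r1 a g : r - 3 <= a -> a <= r - 1 ->
  g \in G 0 (r - 1) -> g \in G a r -> g \in G a (r - 1).
Proof.
move=> ar ar1 g0 ga; have a3 : 3 <= a by clear - ar r_ge; lia.
have [a_eq|a_neq] := eqVneq a (r - 1)%N.
  have r1 : r - 1 < r by clear - r_ge; lia.
  have [->|g_rho] : g = 1 \/ g = rho (r - 1); [|exact: group1|].
  { move: g ga {g0}; rewrite a_eq; apply: interval_ind => [|g h [->|->] [->|->]|k kr kab];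
      rewrite ?mul1g ?mulg1.
    1-5: by [left | right | left; apply: rho_invol].
    by right; suffices -> : k = r - 1 by []; clear - kab kr; lia. }
  have n0 : M + r < n by clear - n_def r_ge; lia.
  have st := top_stable g0; have := st (pt (M + r)); rewrite g_rho rho_pt // !val_point //; last first.
    by apply: act_lt.
  by repeat eval_act; clear - r_ge; lia.
have ar2 : a <= r - 2 by clear - ar1 a_neq; lia.
have [h hG [gh1 gh0]] := fix_top ar ar2 g0 ga.
have hr : h \in G a r by apply: subsetP hG; apply: intervalS; clear; lia.
have h0 : h \in G 0 (r - 1) by apply: subsetP hG; apply: intervalS.
rewrite -(groupMr _ hG); have ghr : g * h \in G a r by rewrite groupM.
move: {hG g0 ga h0 hr} (g * h) ghr gh1 gh0 => {g h} g ga g1 g0.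
have gS : supported (pairs a (r - 1)) g.
  have ar' : a <= (r - 1).+1 by clear - ar1; lia.
  have r_eq : (r - 1).+1 = r by clear - r_ge; lia.
  apply: (@supported_shrink a r (r - 1) (M + r) g a3 ar1 _ ga) => //.
  - by clear; lia.
  - by left; rewrite r_eq.
  rewrite r_eq in ar' *; apply: (@supported_shrink a r r (M + r + 1) g a3 ar' _ ga) => //.
    by left; clear; lia.
  by apply: (interval_pairs a3 _ ga).
have [a_eq|a_neq2] := eqVneq a (r - 3)%N.
  apply: (sheet_subgroup (H := interval_group_group r rho a (r - 1)) y_sheetP a3 ar1) => //.
  - by clear - r_ge; lia.
  - by apply: intervalS => //; clear; lia.
  - by apply: y_pairs_mem => //; clear - a_eq r_ge; lia.
  move=> j jab; apply: bounded_sheet_image => //; last by clear; lia.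
  by right; apply: (y_stable ar ga).
have a_eq : a = r - 2 by clear - ar2 ar a_neq2; lia.
rewrite a_eq in ga gS.
have blk := block_stable ga.
have fixm x : M + r - 2 <= mirror x <= M + r + 1 -> x < n -> mirror (mirror x) = x ->
    g (pt (mirror x)) = pt (mirror x) -> g (pt x) = pt x.
  move=> xP xn mx gmx; apply: val_inj; have mn : mirror x < n by clear - xP n_def r_ge; lia.
  by have [_] := blk _ xP; rewrite mx gmx /= !val_point ?mx.
have m1 : mirror (M + r - 1) = (M + r)%N by rewrite /mirror; clear - r_ge; lia.
have a3' : 3 <= r - 2 by rewrite -a_eq.
have r_eq : (r - 2).+1 = r - 1 by clear - r_ge; lia.
have gtop : g (pt (M + r - 1)) = pt (M + r - 1).
  by apply: fixm; rewrite ?m1 //; rewrite ?/mirror; clear - r_ge n_def; lia.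
have gS2 : supported (pairs (r - 2) (r - 2)) g.
  apply: (supported_shrink a3' _ _ ga _ _ gtop) => //.
  - by clear; lia.
  - by left; rewrite r_eq; clear - r_ge; lia.
  by rewrite r_eq.
have m2 : mirror (M + r - 2) = (M + r + 1)%N by rewrite /mirror; clear - r_ge; lia.
have gbot : g (pt (M + r - 2)) = pt (M + r - 2).
  by apply: fixm; rewrite ?m2 //; rewrite ?/mirror; clear - r_ge n_def; lia.
rewrite (supported_one_pair _ ga _ gS2 gbot) ?group1 //.
  by rewrite a3'; clear; lia.
by left; clear - r_ge; lia.
Qed.

(** y_(r+1) lies on the twisted sheet and outside the support of g, so g cannot exchange the sheet
    with its mirror image. *)
Lemma twisted_fixed g b : b <= r - 1 -> g \in G (r - 4) r -> supported (pairs (r - 4) b) g ->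
  forall x : 'I_n, pairs (r - 4) r.+1 x -> twisted (g x) = twisted x.
Proof.
move=> br ga gS; have [e gP] := twisted_stable ga.
have n1 : M + r + 1 < n by clear - n_def r_ge; lia.
have top : g (pt (M + r + 1)) = pt (M + r + 1).
  by apply: gS; rewrite val_point // /pairs; clear - br r_ge; lia.
have topP : pairs (r - 4) r.+1 (pt (M + r + 1)).
  by rewrite val_point // /pairs; clear - r_ge; lia.
have [_] := gP _ topP; rewrite top; case: e gP => [|] gP; first by rewrite addbT; case: (twisted _).
by move=> _ x xP; have [_ ->] := gP x xP; rewrite addbF.
Qed.

Lemma interval_cap_pairs a b g : 3 <= a -> a <= b -> b < r -> a <= r - 4 \/ b <= r - 4 ->
  g \in G 0 b -> g \in G a r -> g \in G a b.
Proof.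
move=> a3 ab br abr g0 ga.
have b3 : 3 <= b by clear - a3 ab; lia.
have b_r : b <= r by clear - br; lia.
have b_r1 : b <= r.+1 by clear - br; lia.
have b_r' : b <= r - 1 by clear - br; lia.
have sub0 : G a b \subset G 0 b by apply: intervalS.
have subr : G a b \subset G a r by apply: intervalS.
have [h hG hS] := split_lower_pairs b3 br abr g0.
have hV : h^-1 \in G a b by rewrite groupV.
rewrite -(groupMl _ hV).
have {g0}g0 : h^-1 * g \in G 0 b by rewrite groupM // (subsetP sub0).
have {ga}ga : h^-1 * g \in G a r by rewrite groupM // (subsetP subr).
move: {h hG hV} (h^-1 * g) hS g0 ga => {}g gS g0 ga.
have {}gS : supported (pairs a b) g.
  have gr := interval_pairs a3 (leqnn r) ga.
  move=> x xP; have [xU|/gS//] := boolP ((x <= M + b) || (M + r + 2 <= x <= M + r - 1 + b))%N.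
  apply: gr; apply: contra xP; rewrite /pairs; clear - xU b_r r_ge; lia.
have image st j := @bounded_sheet_image a b g j a3 gS (or_introl st) b_r.
have [br3|br2] := leqP b (r - 3).
  have st := lower_stable br3 b3 g0.
  (* In the exceptional interval no pair transposition is available. There g preserves both the y
     side and the twisted sheet, and y_(r-3) is on the twisted sheet while y_(r-4) is not, so g is
     trivial. *)
  have [[ar4 b_eq]|ab'] : (a = r - 4 /\ b = r - 3) \/ ~ (a = r - 4 /\ b = r - 3).
  - by clear; lia.
  { have tw := twisted_fixed b_r'; rewrite ar4 b_eq in ga gS tw st image *.
    have fixed j : r - 4 <= j <= r - 3 -> g (pt (y_sheet j)) = pt (y_sheet j).
      move=> jr; have [i ir gi] := image st j jr; rewrite gi.
      have jn : y_sheet j < n by rewrite /y_sheet; clear - jr n_def r_ge; lia.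
      have inn : y_sheet i < n by rewrite /y_sheet; clear - ir n_def r_ge; lia.
      have jP : pairs (r - 4) r.+1 (pt (y_sheet j)).
        by rewrite val_point // /pairs /y_sheet; clear - jr r_ge; lia.
      have := tw g ga gS _ jP; rewrite gi !val_point // /twisted /y_sheet => e.
      by congr pt; clear - e ir jr r_ge; lia.
    have r4 : 3 <= r - 4 by clear - r_ge; lia.
    have gS' : supported (pairs (r - 4) (r - 4)) g.
      apply: (supported_shrink r4 _ _ ga _ _ (fixed (r - 3)%N _)).
      - by clear; lia.
      - by clear; lia.
      - by left; rewrite /y_sheet; clear - r_ge; lia.
      - by rewrite (_ : (r - 4).+1 = r - 3)%N //; clear - r_ge; lia.
      - by clear - r_ge; lia.
    rewrite (supported_one_pair _ ga _ gS' (fixed (r - 4)%N _)) ?group1 //.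
    - by rewrite r4; clear; lia.
    - by left.
    by clear - r_ge; lia. }
  apply: (sheet_subgroup (H := interval_group_group r rho a b) y_sheetP a3 ab b_r1) => //.
    by apply: y_pairs_mem => //; clear - ab' br3 abr; lia.
  by move=> j; apply: image.
have ar4 : a <= r - 4 by clear - abr br2; lia.
have br2' : r - 2 <= b by clear - br2; lia.
(* With rho_(r-5) present all pair transpositions and flips are available, and parity decides;
   without it, a = r-4 and the twisted sheet is preserved. *)
have [ar5|ar5] := leqP a (r - 5).
  have uH := y_pairs_mem a3 b_r (or_intror (or_introl ar5)) b_r'.
  apply: (even_pairs_subgroup (H := interval_group_group r rho a b) a3 ab b_r1) => //.
  apply: (flip2_gen (H := interval_group_group r rho a b) a3 b_r1 uH
    (p := r - 3) (q := r - 2)).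
  - by clear - ar5 br2'; lia.
  - by clear - ar5 br2'; lia.
  - by clear - r_ge; lia.
  exact: flip2_top_mem.
have a_eq : a = r - 4 by clear - ar5 ar4 r_ge; lia.
apply: (sheet_subgroup (H := interval_group_group r rho a b)
  twisted_sheetP a3 ab b_r1) => //.
  exact: twisted_pairs_mem.
move=> j jab; rewrite {}a_eq in ga gS jab *.
have twn i : r - 4 <= i <= b -> twisted_sheet i < n.
  by rewrite /twisted_sheet; clear - b_r n_def r_ge; case: (i =P r - 4)%N; lia.
have jP : pairs (r - 4) r.+1 (pt (twisted_sheet j)).
  by rewrite val_point ?twn // /twisted_sheet /pairs; clear - jab b_r r_ge; case: (j =P r - 4)%N; lia.
have tj : twisted (twisted_sheet j).
  by rewrite /twisted_sheet /twisted; clear - jab b_r r_ge; case: (j =P r - 4)%N; lia.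
have := twisted_fixed b_r' ga gS jP; rewrite val_point ?twn // tj => tg.
have gP : pairs (r - 4) b (g (pt (twisted_sheet j))).
  apply: contraT => gx; have /perm_inj xy := gS _ gx.
  move: gx; rewrite xy val_point ?twn // /pairs /twisted_sheet.
  by clear - jab b_r r_ge; case: (j =P r - 4)%N; lia.
have [i ib gi] : exists2 i, r - 4 <= i <= b & g (pt (twisted_sheet j)) = twisted_sheet i :> nat.
  move: (nat_of_ord (g _)) tg gP => y; rewrite /twisted /pairs /twisted_sheet.
  case: (y =P M + 2 * r - 5)%N => [->|y_neq] tg gP.
    by exists (r - 4)%N; [clear - br2'; lia | rewrite eqxx; clear - r_ge; lia].
  exists (y - M)%N; first by clear - tg gP b_r r_ge y_neq; lia.
  by rewrite ifF; clear - tg gP b_r r_ge y_neq; lia.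
by exists i => //; apply: val_inj; rewrite /= val_point ?twn.
Qed.

Lemma interval_cap a b : 0 < a -> a <= b -> b < r -> G 0 b :&: G a r \subset G a b.
Proof.
move=> a_gt0 ab br.
have [a3|a2] := leqP 3 a; last first.
  have a12 : 0 < a <= 2 by rewrite a_gt0.
  have [b1|[b2|b3]] : b = 1%N \/ b = 2 \/ 3 <= b by clear - a_gt0 ab; lia.
  - have a1 : a = 1%N by clear - a_gt0 ab b1; lia.
    by rewrite b1 a1; apply: interval_cap_1.
  - by rewrite b2; apply: interval_cap_2.
  exact: interval_cap_low.
apply/subsetP=> g /setIP[g0 ga].
have [low|[ar high]] : (a <= r - 4 \/ b <= r - 4) \/ r - 3 <= a /\ r - 3 <= b.
- by clear - r_ge; lia.
- exact: interval_cap_pairs.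
have [b_eq|b_neq] := eqVneq b (r - 1)%N.
  rewrite b_eq in ab g0 *; exact: interval_cap_r1.
apply: interval_cap_plain => //.
by clear - br b_neq; lia.
Qed.

End Graph.

Theorem theorem4p10 (n r : nat) :
  (19 <= n)%N -> n %% 4 = 3 -> ~~ odd r -> (8 <= r)%N -> (2 * r < n - 3)%N ->
  let rho := label_perm n (edges410 n r) in
  let G := label_group n (edges410 n r) r in
  (G \isog 'Alt_('I_n))%g /\
  is_string_C_group r rho /\
  schlafli_type r rho = schlafli410 n r.
Proof.
move=> n19 n4 r_even r_ge rn rho G.
have n_gt0 : 0 < n by clear - n19; lia.
pose M := n - 2 * r - 1.
have M_mod : M %% 4 = 2 by rewrite /M; clear - n4 r_even rn; lia.
(* The bound on r only gives M >= 3; the congruence raises this to 6. *)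
have M_ge : 6 <= M by move: M_mod; rewrite /M; clear - n4 rn r_even; lia.
have n_def : n = M + 2 * r + 1 by rewrite /M; clear - rn; lia.
split; [|split; first split].
- suffices -> : G = 'Alt_('I_n) by apply: isog_refl.
  rewrite -(@interval_group_full n M r) // /G /label_group.
  congr <<_>>; apply/setP=> g; apply/imsetP/imsetP=> -[k _ ->]; exists k => //.
  by rewrite inE /=.
- exact: (@rho_sggi n M r).
- apply: intersection_property_of_intervals.
    exact: (@rho_comm n M r).
  exact: (@interval_cap n M r).
exact: (@schlafli_typeE n M r).
Qed.
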